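(* Let $k\geq1$ be an integer and let $G$ be a connected graph of order $n\geq 3(k+2)\delta+2$ with minimum degree $\delta$. If $\rho(G)\geq\rho(K_{\delta}\vee(K_{n-k\delta-2\delta}+I_{k\delta+\delta}))$, then $G$ has a spanning tree with leaf degree at most $k$ unless $G\cong K_{\delta}\vee(K_{n-k\delta-2\delta}+I_{k\delta+\delta})$.
   Context: All graphs are finite and simple. $\rho(G)$ is the spectral radius of the adjacency matrix of $G$. For a spanning tree $T$ of $G$, the leaf degree of a vertex $v$ of $T$ is the number of leaves of $T$ adjacent to $v$ in $T$, and the leaf degree of $T$ is the maximum leaf degree over all vertices of $T$. $K_n$ is the complete graph and $I_n$ the edgeless graph on $n$ vertices; $G_1+G_2$ denotes disjoint union and $G_1\vee G_2$ the join. *)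

(* Defs.v *)
From HB Require Import structures.
From mathcomp Require Import all_boot all_order all_algebra algC.
Set Implicit Arguments. Unset Strict Implicit. Unset Printing Implicit Defensive.
Import Order.TTheory GRing.Theory Num.Theory.
Local Open Scope ring_scope.

Definition simple_graph n (e : rel 'I_n) : Prop := symmetric e /\ irreflexive e.

Definition gconnected n (e : rel 'I_n) : Prop := forall x y, connect e x y.

Definition deg n (e : rel 'I_n) (x : 'I_n) : nat := #|[set y | e x y]|.

(* minimum degree (n is a harmless default for the empty vertex set) *)
Definition min_degree n (e : rel 'I_n) : nat := \big[minn/n]_(x : 'I_n) deg e x.

Definition adj n (e : rel 'I_n) : 'M[algC]_n := \matrix_(i, j) (e i j)%:R.

(* The eigenvalues (with multiplicity) of A : the roots of its characteristic
   polynomial in the algebraically closed field algC. *)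
Definition eigen_seq n (A : 'M[algC]_n) : seq algC :=
  sval (closed_field_poly_normal (char_poly A)).

Definition spectral_radius n (A : 'M[algC]_n) : algC :=
  \big[Num.max/0]_(z <- eigen_seq A) `|z|.

Definition rho n (e : rel 'I_n) : algC := spectral_radius (adj e).

Definition isomorphic n (e1 e2 : rel 'I_n) : Prop :=
  exists f : 'I_n -> 'I_n, bijective f /\ forall x y, e1 x y = e2 (f x) (f y).

Definition acyclic n (t : rel 'I_n) : Prop :=
  forall s : seq 'I_n, uniq s -> (2 < size s)%N -> ~~ cycle t s.

Definition spanning_tree n (e t : rel 'I_n) : Prop :=
  symmetric t /\ subrel t e /\ gconnected t /\ acyclic t.

Definition is_leaf n (t : rel 'I_n) (x : 'I_n) : bool := deg t x == 1%N.

Definition leaf_deg_vertex n (t : rel 'I_n) (v : 'I_n) : nat :=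
  #|[set u | t v u & is_leaf t u]|.

Definition leaf_degree n (t : rel 'I_n) : nat :=
  \max_(v : 'I_n) leaf_deg_vertex t v.

(* K_d \/ (K_{n - k d - 2 d} + I_{k d + d}) on 'I_n:
   vertices 0..d-1 form K_d, vertices d..n-(k+1)d-1 form the clique
   K_{n-kd-2d}, the remaining (k+1)d vertices are independent. *)
Definition extremal_graph n (k d : nat) : rel 'I_n :=
  fun i j => (i != j) && ((minn i j < d)%N || (maxn i j < n - (k + 1) * d)%N).
Arguments extremal_graph : clear implicits.

(* Main.v *)
(* Let S be a nonempty set of s vertices and i(G-S) the number of isolated
   vertices of G-S.  If i(G-S) < (k+1)s for every such S, a spanning tree of
   leaf degree at most k exists (Kaneko).  By an alternating-path argument G has
   a spanning family of stars with at least one and at most k+1 leaves; choose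
   it extremal.  A star is harmless in a spanning tree containing all the stars
   unless it is full, i.e. has k+1 leaves, all of them still leaves of the tree.
   Full stars are linked through one of their leaves to stars already
   treated; if this gets stuck, the centers of the remaining full stars (other
   than triangles, which occur only for k = 1) form a set violating the
   condition.

   Hence, if there is no such tree, some S has i(G-S) >= (k+1)s, and G is a
   spanning subgraph of H_s = K_s \/ (K_{n-(k+2)s} + I_{(k+1)s}), with
   s >= delta since isolated vertices of G-S have degree at most s.  Put
   x = rho(G) >= rho(H_delta).  If s = delta and G <> H_s, the Perron vector of G
   gives rho(G) < rho(H_delta).  If s > delta, the vector with entries 1 on K_s,
   s/x on I_{(k+1)s} and s/(x+1-n+(k+2)s) elsewhere is mapped by the adjacency
   matrix of H_s below its multiple by x, strictly so on K_s; pairing it with the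
   positive Perron vector of G contradicts rho(G) = x.  The strict inequality for
   s is deduced from the weak one for delta, which expresses
   rho(H_delta) <= x. *)

Require Import Defs.
From HB Require Import structures.
From mathcomp Require Import all_boot all_order all_algebra algC.
From mathcomp Require Import zify ring.
Set Implicit Arguments. Unset Strict Implicit. Unset Printing Implicit Defensive.

(** * Star factors *)

Definition isolated n (e : rel 'I_n) (S : {set 'I_n}) : {set 'I_n} :=
  [set x | (x \notin S) && [forall y, e x y ==> (y \in S)]].

(* A family of vertex-disjoint stars is encoded by the idempotent map sending
   every vertex to the center of its star; a fixed point without leaves is a
   trivial star. *)
Section Stars.
Variables (n : nat) (e : rel 'I_n).
Hypotheses (sym_e : symmetric e) (irr_e : irreflexive e).
Implicit Types (f g : {ffun 'I_n -> 'I_n}) (x y z w : 'I_n).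

Definition leaves f y : {set 'I_n} := [set x | (x != y) && (f x == y)].
Definition load f y : nat := #|leaves f y|.

Definition star_packing m f : bool :=
  [&& [forall x, f (f x) == f x], [forall x, (f x != x) ==> e x (f x)]
    & [forall y, load f y <= m]].

Lemma star_packingP m f : reflect
  [/\ forall x, f (f x) = f x, forall x, f x != x -> e x (f x)
    & forall y, load f y <= m] (star_packing m f).
Proof.
apply: (iffP and3P) => -[f1 f2 f3].
  split=> [x|x|y]; [exact/eqP/(forallP f1)|exact/implyP/(forallP f2)|exact/(forallP f3)].
split; apply/forallP=> x; [by apply/eqP|by apply/implyP/f2|exact: f3].
Qed.

Definition lone f : {set 'I_n} := [set x | (f x == x) && (load f x == 0)].

Definition reassign f x y : {ffun 'I_n -> 'I_n} :=
  [ffun z => if z == x then y else f z].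

Lemma reassignE f x y z : reassign f x y z = if z == x then y else f z.
Proof. by rewrite ffunE. Qed.

(** The subtraction is exact: when the subtrahend is 1, [x] itself is among the leaves of [z]. *)
Lemma load_reassign f x y z :
  load (reassign f x y) z =
    load f z - (f x == z) && (x != z) + (y == z) && (x != z).
Proof.
rewrite /load (cardsD1 x (leaves f z)) (cardsD1 x (leaves (reassign f x y) z)).
have -> : leaves (reassign f x y) z :\ x = leaves f z :\ x.
  by apply/setP=> w; rewrite !inE reassignE; case: (w == x).
rewrite !inE reassignE eqxx ![(x != z) && _]andbC addKn.
by rewrite addnC.
Qed.

Lemma load_eq0 f x : (forall z, f (f z) = f z) -> f x != x -> load f x = 0.
Proof.
move=> ff fx; apply: eq_card0 => z; rewrite !inE; apply/negP => /andP[_ /eqP fz].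
by rewrite -fz ff fz eqxx in fx.
Qed.

Lemma load0P f x z : load f x = 0 -> f z = x -> z = x.
Proof.
move/eqP; rewrite cards_eq0 => /eqP lv0 fz; apply/eqP/negPn/negP => zx.
have : z \in leaves f x by rewrite inE zx fz eqxx.
by rewrite lv0 inE.
Qed.

(** Nothing is attached to [x], so it can become a trivial star, or a leaf of a centre with room,
    while every other vertex keeps its centre. *)
Lemma star_packing_reassign m f x y : star_packing m f -> load f x = 0 ->
    [\/ y = x | [/\ y != x, f y = y, e x y & load f y < m]] ->
  star_packing m (reassign f x y).
Proof.
move=> /star_packingP[ff ef lf] lx yP; apply/star_packingP; split=> [z|z|z].
- rewrite !reassignE; case: (z =P x) => [_|zx].
    by case: yP => [->|[/negPf-> ->]]; rewrite ?eqxx.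
  by case: (f z =P x) => [/(load0P lx)//|_]; rewrite ff.
- rewrite reassignE; case: (z =P x) => [->|_]; last exact: ef.
  by case: yP => [->|[]]; rewrite ?eqxx.
- rewrite load_reassign; case: yP => [->|[yx fy exy ly]].
    by have := lf z; case: (x == z); rewrite /= ?andbF; lia.
  by have := lf z; case: (y =P z) => [<-|_] /=; lia.
Qed.

Lemma sum_load f (R : {set 'I_n}) :
  \sum_(y in R) load f y = #|[set z | (f z != z) && (f z \in R)]|.
Proof.
rewrite -[RHS]sum1_card [RHS](partition_big f (mem R)) /= => [|z]; last first.
  by rewrite inE => /andP[].
apply: eq_bigr => y yR; rewrite /load -sum1_card; apply: eq_bigl => z.
by rewrite !inE; case: (f z =P y) => [->|]; rewrite ?andbF ?yR ?andbT // eq_sym.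
Qed.

(** * Star packings with the fewest trivial stars *)

Section Exists.
Variable m : nat.
Hypothesis m_gt1 : 1 < m.

Definition min_packing f : Prop :=
  star_packing m f /\ forall g, star_packing m g -> #|lone f| <= #|lone g|.

(** Otherwise [x] could be attached to [y], which removes a trivial star and creates none. *)
Lemma lone_center_full f x y :
  min_packing f -> x \in lone f -> e x y -> f y = y -> load f y = m.
Proof.
move=> [pf min_f] xl exy fy; have [ff ef lf] := star_packingP _ _ pf.
have := xl; rewrite inE => /andP[/eqP fx /eqP lx].
have yx : y != x by apply: contraTneq exy => ->; rewrite irr_e.
apply/eqP; rewrite eqn_leq lf /= leqNgt; apply/negP => ly.
have /min_f := star_packing_reassign pf lx (or_intror (And4 yx fy exy ly)).
apply/negP; rewrite -ltnNge [X in _ < X](cardsD1 x) xl ltnS.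
apply/subset_leq_card/subsetP=> z; rewrite !inE reassignE load_reassign fx.
have [->|zx] := eqVneq z x; first by rewrite (negPf yx).
by rewrite /= subn0 addn_eq0 => /and3P[-> ->].
Qed.

(** If [y] were a leaf with centre [w], it could leave its star and form a new one with [x]. By
    minimality [w] would become trivial; but it is adjacent to the centre [y] of load 1, against
    [lone_center_full]. *)
Lemma lone_nbr_full f x y :
  min_packing f -> x \in lone f -> e x y -> f y = y /\ load f y = m.
Proof.
move=> minf xl exy; have [fy|fy] := eqVneq (f y) y.
  by split=> //; apply: lone_center_full minf xl exy fy.
have [pf min_f] := minf; have [ff ef lf] := star_packingP _ _ pf.
have := xl; rewrite inE => /andP[/eqP fx /eqP lx].
have yx : y != x by apply: contraTneq exy => ->; rewrite irr_e.
pose w := f y; pose f1 := reassign f y y; pose f2 := reassign f1 x y.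
have ly := load_eq0 ff fy.
have wx : w != x.
  by apply: contraNneq fy => wx; rewrite (load0P lx wx) fx.
have pf1 : star_packing m f1 by apply: star_packing_reassign => //; left.
have f1y : f1 y = y by rewrite reassignE eqxx.
have f1x : f1 x = x by rewrite reassignE eq_sym (negPf yx).
have l1 z : load f1 z = load f z - (w == z) && (y != z).
  by rewrite load_reassign; case: (y == z); rewrite /= ?andbF ?addn0.
have pf2 : star_packing m f2.
  apply: star_packing_reassign => //; first by rewrite l1 lx.
  by right; split; rewrite // l1 ly; lia.
have l2 z : z != x -> load f2 z = load f1 z + (y == z).
  by move=> zx; rewrite load_reassign f1x [x == z]eq_sym (negPf zx) subn0 andbT.
have f2x : f2 x = y by rewrite reassignE eqxx.
have l2y : load f2 y = 1 by rewrite l2 // l1 ly eqxx; lia.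
have sub2 z : z \in lone f2 -> z != x /\ (z = w \/ z \in lone f).
  rewrite inE => /andP[/eqP f2z /eqP l2z].
  have zx : z != x by apply: contraNneq yx => zx; rewrite -f2x -zx f2z zx.
  have zy : z != y by apply: contra_eq_neq l2z => ->; rewrite l2y.
  split=> //; have [->|zw] := eqVneq z w; [by left|right].
  move: f2z; rewrite !reassignE (negPf zx) (negPf zy) inE => ->; rewrite eqxx /=.
  by move/eqP: l2z; rewrite l2 // l1 [w == z]eq_sym (negPf zw) /= subn0 addn_eq0 => /andP[].
have sub_lone2 : lone f2 :\ w \subset lone f :\ x.
  by apply/subsetP=> z; rewrite 2!in_setD1 => /andP[/negPf zw] => /sub2[-> []] // zE; rewrite zE eqxx in zw.
(* At most [w] has replaced [x] among the trivial stars, so the new packing is minimal too. *)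
have min2 : min_packing f2.
  split=> // g /min_f; apply: leq_trans.
  rewrite [X in X <= _](cardsD1 w) [X in _ <= X](cardsD1 x) xl.
  by apply: leq_add; [case: (_ \in _)|apply: subset_leq_card].
have w2 : w \in lone f2.
  apply/negPn/negP => w2; have := min_f _ pf2; apply/negP.
  rewrite -ltnNge [X in X < _](cardsD1 w) (negPf w2) [X in _ < X](cardsD1 x) xl.
  by rewrite ltnS; apply: subset_leq_card.
have := lone_center_full min2 w2 (y := y).
rewrite sym_e ef // l2y reassignE (negPf yx) f1y => /(_ isT erefl) m1.
by have := m_gt1; rewrite -m1.
Qed.

(** One move of an alternating path: the full star at [y] gives up its leaf [z] in exchange for [x],
    so the trivial star travels from [x] to [z]. *)
Lemma min_packing_shift f x z (y := f z) :
    min_packing f -> x \in lone f -> e x y -> z != y ->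
    let g := reassign (reassign f z z) x y in
  [/\ min_packing g, z \in lone g & forall w, w != x -> load g w = load f w].
Proof.
move=> minf xl exy zy g; have [fy ly] := lone_nbr_full minf xl exy.
have [pf min_f] := minf; have [ff ef lf] := star_packingP _ _ pf.
have := xl; rewrite inE => /andP[/eqP fx /eqP lx].
have yx : y != x by apply: contraTneq exy => ->; rewrite irr_e.
have zx : z != x by apply: contraNneq yx => zx; rewrite /y zx fx.
have lz : load f z = 0 by apply: load_eq0 => //; rewrite eq_sym.
pose f1 := reassign f z z.
have pf1 : star_packing m f1 by apply: star_packing_reassign => //; left.
have l1 w : load f1 w = load f w - (y == w) && (z != w).
  by rewrite load_reassign; case: (z == w); rewrite /= ?andbF ?addn0.
have f1x : f1 x = x by rewrite reassignE eq_sym (negPf zx).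
have f1y : f1 y = y by rewrite reassignE eq_sym (negPf zy).
have pg : star_packing m g.
  apply: star_packing_reassign => //; first by rewrite l1 lx.
  by right; split; rewrite // l1 ly eqxx zy /=; lia.
have lg w : w != x -> load g w = load f w.
  move=> wx; rewrite load_reassign f1x l1 [x == w]eq_sym (negPf wx) andbT subn0.
  have [<-|] := eqVneq y w; last by rewrite /= subn0 addn0.
  by rewrite zy ly /=; lia.
have sub_lone : lone g \subset z |: (lone f :\ x).
  apply/subsetP=> w; rewrite !inE => /andP[gw lgw].
  have wx : w != x.
    by apply: contraTneq gw => ->; rewrite /g reassignE eqxx.
  rewrite lg // in lgw; rewrite wx lgw; have [//|wz] := eqVneq w z.
  by move: gw; rewrite /g !reassignE (negPf wx) (negPf wz) => ->.
split; [|by rewrite inE lg // lz /g !reassignE (negPf zx) !eqxx|exact: lg].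
split=> // h /min_f; apply: leq_trans; apply: leq_trans (subset_leq_card sub_lone) _.
rewrite cardsU1 [X in _ <= X](cardsD1 x) xl leq_add2r.
by case: (_ \notin _).
Qed.

Let step f : rel 'I_n := fun x z => e x (f z) && (f z != z).

Lemma step_path_eq f g z p :
    (forall b, b \in p -> f b != b -> g b = f b) ->
  path (step f) z p -> path (step g) z p.
Proof.
elim: p z => //= b p IHp z gb /andP[/andP[ezb fbb] bp].
rewrite /step gb ?mem_head // ezb fbb /=; apply: IHp bp => c cp.
by apply: gb; rewrite inE cp orbT.
Qed.

(* The alternating-path argument: shifting the stars along a path from a
   trivial star makes the end of the path trivial instead. *)
Lemma reachable_nbr_full N f x p y :
    size p < N -> min_packing f -> x \in lone f -> path (step f) x p ->
    e (last x p) y ->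
  f y = y /\ load f y = m.
Proof.
elim: N => // N IHN in f x p *; case: p => [|z p] /=.
  by move=> _ minf xl _; apply: lone_nbr_full.
rewrite ltnS => ltpN minf xl /andP[/andP[exfz fz] zp] ey.
have [pf min_f] := minf; have [ff ef lf] := star_packingP _ _ pf.
have := xl; rewrite inE => /andP[/eqP fx /eqP lx].
(* A step depends only on the centre of its target. A later vertex [b] in the star of [z] is thus
   reached from [x] directly, which shortens the path. *)
have [/hasP[b bp /eqP fb]|/hasPn no_fz] := boolP (has (fun b => f b == f z) p).
  case/splitPr: bp => p1 p2 in ltpN zp ey.
  rewrite size_cat /= in ltpN; rewrite last_cat /= in ey.
  move: zp; rewrite cat_path /= => /and3P[_ /andP[_ fbb] bp2].
  apply: (IHN f x (b :: p2)) => //=; first by lia.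
  by rewrite bp2 /step fbb fb exfz.
have fzz : z != f z by rewrite eq_sym.
(* No later vertex of the path lies in the star of [z], so after the shift the rest of the path
   still consists of steps, starting at the trivial star [z]. *)
have [ming zl lg] := min_packing_shift minf xl exfz fzz.
set g := reassign _ _ _ in ming zl lg.
have gb b : b \in p -> f b != b -> g b = f b.
  move=> bp fbb; rewrite !reassignE; case: eqP => [bx|_].
    by rewrite bx fx eqxx in fbb.
  by case: eqP => [bz|//]; have := no_fz b bp; rewrite bz eqxx.
have [gy lgy] := IHN g z p ltpN ming zl (step_path_eq gb zp) ey.
have yx : y != x.
  apply: contra_eq_neq gy => ->; rewrite /g reassignE eqxx.
  by apply: contraTneq exfz => ->; rewrite irr_e.
rewrite lg // in lgy; split=> //; move: gy; rewrite /g !reassignE (negPf yx).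
by case: eqP => // yz; have := m_gt1; rewrite -lgy yz load_eq0.
Qed.

(** Let [I] be reached by alternating paths from a trivial star [x], and let [R] be its
    neighbourhood. All of [R] are full centres, [I] is isolated once [R] is removed, and [I]
    contains [x] besides the leaves of these stars: at least [m * #|R| + 1] vertices, too many. *)
Lemma packing_without_lone :
    (forall x, exists y, e x y) ->
    (forall S : {set 'I_n}, S != set0 -> #|isolated e S| <= m * #|S|) ->
  exists2 f, star_packing m f & lone f = set0.
Proof.
move=> no_iso few_iso.
have pack_id : star_packing m [ffun x => x].
  apply/star_packingP; split=> x; rewrite ?ffunE ?eqxx //.
  by rewrite /load eq_card0 // => z; rewrite !inE ffunE; case: eqP.
case: (arg_minnP (fun f => #|lone f|) pack_id) => f pf min_f.
have minf : min_packing f by [].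
exists f => //; apply/eqP/negPn/negP => /set0Pn[x xl].
have [ff ef lf] := star_packingP _ _ pf.
have := xl; rewrite inE => /andP[/eqP fx /eqP lx].
pose I := [set z | connect (step f) x z].
pose R := [set y | [exists z, (z \in I) && e z y]].
have R_full y : y \in R -> f y = y /\ load f y = m.
  rewrite !inE => /existsP[z /andP[]]; rewrite inE => /connectP[p xp ->] ey.
  exact: (reachable_nbr_full (ltnSn _) minf xl xp ey).
have I_moved z : z \in I -> z = x \/ f z != z.
  rewrite inE => /connectP[p]; case/lastP: p => [_ ->|p b]; first by left.
  by rewrite rcons_path last_rcons => /andP[_ /andP[_ fbb]] ->; right.
have I_iso : I \subset isolated e R.
  apply/subsetP=> z zI; rewrite !inE; apply/andP; split.
    apply/negP => zR; have [|fz lz] := R_full z; first by rewrite inE.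
    case: (I_moved z zI) => [zx|]; last by rewrite fz eqxx.
    by have := m_gt1; rewrite -lz zx lx.
  by apply/forallP=> y; apply/implyP=> ezy; rewrite inE; apply/existsP; exists z; rewrite zI.
have leaves_I : x |: [set z | (f z != z) && (f z \in R)] \subset I.
  apply/subsetP=> z; rewrite in_setU1 => /predU1P[->|]; first by rewrite inE.
  rewrite inE => /andP[fz]; rewrite inE => /existsP[w /andP[wI ew]].
  rewrite inE in wI; rewrite inE; apply: connect_trans wI (connect1 _).
  by rewrite /step ew.
have := subset_leq_card (subset_trans leaves_I I_iso).
rewrite cardsU1 inE fx eqxx /= -sum_load.
rewrite (eq_bigr (fun=> m)) => [|y /R_full[]//]; rewrite sum_nat_const.
have [y exy] := no_iso x; have R0 : R != set0.
  by apply/set0Pn; exists y; rewrite inE; apply/existsP; exists x; rewrite exy inE connect0.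
by move=> ltR; have := leq_trans ltR (few_iso R R0); rewrite mulnC add1n ltnn.
Qed.

End Exists.
End Stars.

(** * Forests *)

Section Forests.
Variable n : nat.
Implicit Types (t : rel 'I_n) (x y : 'I_n).

Definition add_edge t a b : rel 'I_n :=
  fun x y => [|| t x y, (x == a) && (y == b) | (x == b) && (y == a)].

Lemma add_edge_sym t a b : symmetric t -> symmetric (add_edge t a b).
Proof.
move=> sym_t x y; rewrite /add_edge sym_t; congr (_ || _).
by rewrite orbC ![_ && (x == _)]andbC.
Qed.

(** A cycle would use the new edge exactly once, and the rest of it would connect [a] to [b] in
    [t]. *)
Lemma acyclic_add_edge t a b :
    symmetric t -> acyclic t -> ~~ connect t a b -> acyclic (add_edge t a b).
Proof.
move=> sym_t acyc_t nconn s uniq_s size_s; apply/negP => cycle_s.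
have avoid x y : x != a -> y != a -> add_edge t a b x y -> t x y.
  by rewrite /add_edge => /negPf-> /negPf->; rewrite andbF !orbF.
have [a_s|a_s] := boolP (a \in s); last first.
  case/negP: (acyc_t s uniq_s size_s); move: cycle_s.
  apply: (@sub_in_cycle _ (predC1 a)); first by move=> x y /= ? ?; apply: avoid.
  by apply/allP=> x xs /=; apply: contraNneq a_s => <-.
(* Rotated, the cycle reads a, y, ..., z. Only its two edges at [a] can be new, and not both since y
   differs from z. *)
case/rot_to: a_s => i s' Es.
rewrite -(rot_cycle i) Es in cycle_s; rewrite -(rot_uniq i) Es in uniq_s.
rewrite -(size_rot i) Es in size_s.
case: s' Es uniq_s size_s cycle_s => [//|y s1] _.
case: (lastP s1) => [//|s2 z] uniq_s size_s.
rewrite /cycle [path _ _ _]/= rcons_path last_rcons => /and3P[ay yz za].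
move: (uniq_s) => /= /and3P[]; rewrite inE negb_or mem_rcons inE negb_or.
move=> /and3P[a_y a_z a_s2]; rewrite mem_rcons inE negb_or => /andP[y_z y_s2] _.
have {}yz : path t y (rcons s2 z).
  move: yz; apply: (@sub_in_path _ (predC1 a)); first by move=> u v /= ? ?; apply: avoid.
  rewrite /= eq_sym a_y all_rcons /= eq_sym a_z /=.
  by apply/allP=> u us /=; apply: contraNneq a_s2 => <-.
have conn_yz : connect t y z.
  by apply/connectP; exists (rcons s2 z); rewrite // last_rcons.
have csym := sym_connect_sym sym_t.
have {}ay : t a y \/ y = b.
  move: ay; rewrite /add_edge [y == a]eq_sym (negPf a_y) andbF orbF eqxx.
  by case/orP=> [|/eqP]; [left|right].
have {}za : t z a \/ z = b.
  move: za; rewrite /add_edge [z == a]eq_sym (negPf a_z) /= eqxx andbT.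
  by case/orP=> [|/eqP]; [left|right].
case: ay za => [ay|yb] [za|zb].
- case/negP: (acyc_t _ uniq_s size_s).
  by rewrite /cycle /= ay rcons_path last_rcons yz za.
- by case/negP: nconn; rewrite -zb (connect_trans (connect1 ay)).
- by case/negP: nconn; rewrite csym -yb (connect_trans conn_yz (connect1 za)).
- by rewrite yb zb eqxx in y_z.
Qed.

(** Edges of [e] between different components are added one by one; the number of disconnected pairs
    drops each time. *)
Lemma spanning_tree_extend (e t : rel 'I_n) :
    gconnected e -> symmetric e -> symmetric t -> subrel t e -> acyclic t ->
  exists2 t', spanning_tree e t' & subrel t t'.
Proof.
move=> conn_e sym_e.
have [N] := ubnP #|[set p : 'I_n * 'I_n | ~~ connect t p.1 p.2]|.
elim: N t => // N IHN t ltN sym_t sub_t acyc_t.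
have [/existsP[a /existsP[b /andP[eab nab]]]|/existsPn all_conn] :=
  boolP [exists a, exists b, e a b && ~~ connect t a b]; last first.
  exists t => //; split=> //; split=> //; split=> // x y.
  apply: (connect_sub _ (conn_e x y)) => {}x {}y exy.
  by have /existsPn/(_ y) := all_conn x; rewrite exy negbK.
pose t1 := add_edge t a b.
have sub1 : subrel t t1 by move=> x y txy; rewrite /t1 /add_edge txy.
have lt1 : #|[set p : 'I_n * 'I_n | ~~ connect t1 p.1 p.2]| < N.
  rewrite ltnS in ltN; apply: leq_trans ltN; apply: proper_card; apply/properP; split.
    apply/subsetP=> -[x y]; rewrite !inE /=; apply: contra.
    by apply: connect_sub => u v tuv; apply/connect1/sub1.
  exists (a, b); rewrite !inE //= negbK; apply: connect1.
  by rewrite /t1 /add_edge !eqxx orbT.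
have sub_t1 : subrel t1 e.
  move=> x y /or3P[/sub_t //|/andP[/eqP-> /eqP->] //|/andP[/eqP-> /eqP->]].
  by rewrite sym_e.
have [|t' tree_t' sub_t'] := IHN t1 lt1 (add_edge_sym _ _ sym_t) sub_t1.
  exact: acyclic_add_edge.
by exists t' => // x y /sub1 /sub_t'.
Qed.

(** Every vertex of a cycle has two distinct neighbours, whereas each edge here has an end with only
    one. *)
Lemma acyclic_pendant t : symmetric t ->
    (forall x y, t x y -> (forall z, t x z -> z = y) \/ (forall z, t y z -> z = x)) ->
  acyclic t.
Proof.
move=> sym_t pend s uniq_s size_s; apply/negP => cycle_s.
have two_nbrs x : x \in s -> exists y, exists2 z, y != z & t x y && t x z.
  case/rot_to=> i s' Es.
  rewrite -(rot_cycle i) Es in cycle_s; rewrite -(rot_uniq i) Es in uniq_s.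
  rewrite -(size_rot i) Es in size_s.
  case: s' Es uniq_s size_s cycle_s => [//|y s1] _.
  case: (lastP s1) => [//|s2 z] uniq_s size_s.
  rewrite /cycle [path _ _ _]/= rcons_path last_rcons => /and3P[xy _ zx].
  exists y, z; last by rewrite xy sym_t.
  move: uniq_s => /= /and3P[_]; rewrite mem_rcons inE negb_or.
  by case/andP.
case: s uniq_s size_s cycle_s two_nbrs => [//|x [//|y s]] _ _ /= /andP[txy _] two_nbrs.
have [uq|uq] := pend _ _ txy.
  have [u [v uv /andP[/uq uy /uq vy]]] := two_nbrs x (mem_head _ _).
  by rewrite uy vy eqxx in uv.
have y_s : y \in [:: x, y & s] by rewrite !inE eqxx orbT.
have [u [v uv /andP[/uq ux /uq vx]]] := two_nbrs y y_s.
by rewrite ux vx eqxx in uv.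
Qed.

End Forests.

(** * Kaneko's criterion *)

Lemma connected_nbr n (e : rel 'I_n) : gconnected e -> 1 < n ->
  forall x, exists y, e x y.
Proof.
move=> conn_e n_gt1 x; have [y yx] : exists y, y != x.
  apply/existsP; apply: contraTT n_gt1 => /existsPn all_x.
  rewrite -leqNgt -[n]card_ord (@leq_trans 1) //.
  by apply/card_le1P => y _ z; rewrite !inE; have := all_x y; have := all_x z;
     rewrite !negbK => /eqP-> /eqP->; rewrite eqxx.
have /connectP[[|z p] /= ] := conn_e x y; first by move=> _ yE; rewrite yE eqxx in yx.
by case/andP=> exz _ _; exists z.
Qed.

(** * Star factors of maximal score *)

Section OptimalFactor.
Variables (n k : nat) (e : rel 'I_n).
Hypotheses (sym_e : symmetric e) (irr_e : irreflexive e) (conn_e : gconnected e).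
Hypotheses (k_gt0 : 0 < k) (n_gt3 : 3 < n).
Let m := k.+1.
Implicit Types (f g : {ffun 'I_n -> 'I_n}) (x y z w u v : 'I_n).

Definition star_factor f : bool := star_packing e m f && (lone f == set0).

Definition centers f : {set 'I_n} := [set x | f x == x].

(** Maximising these, after the number of centres, controls which vertex of a triangle is its
    centre; see [triangle_outer]. *)
Definition outer_leaves f : {set 'I_n} :=
  [set x | (f x != x) && [exists y, e x y && (f y != f x)]].

(* Lexicographic: the number of outer leaves is at most [n]. *)
Definition score f : nat := #|centers f| * n.+1 + #|outer_leaves f|.

Definition optimal f : Prop :=
  star_factor f /\ forall g, star_factor g -> score g <= score f.

Lemma star_factorP f : reflect
  [/\ forall x, f (f x) = f x, forall x, f x != x -> e x (f x),
      forall y, load f y <= m & forall y, f y = y -> 0 < load f y]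
  (star_factor f).
Proof.
apply: (iffP andP) => [[/star_packingP[ff ef lf] /eqP lone0]|[ff ef lf l0]].
  split=> // y fy; rewrite lt0n; apply/negP => ly.
  have : y \in lone f by rewrite inE fy eqxx.
  by rewrite lone0 inE.
split; first exact/star_packingP.
apply/eqP/setP=> y; rewrite !inE; apply/negP => /andP[/eqP/l0].
by rewrite lt0n => /negPf->.
Qed.

Lemma optimal_exists :
    (forall S : {set 'I_n}, S != set0 -> #|isolated e S| <= m * #|S|) ->
  exists f, optimal f.
Proof.
move=> few_iso; have no_iso := connected_nbr conn_e (ltnW (ltnW n_gt3)).
have [f0 pf0 lf0] := packing_without_lone sym_e irr_e (k_gt0 : 1 < m) no_iso few_iso.
have sf0 : star_factor f0 by rewrite /star_factor pf0 lf0 eqxx.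
by case: (arg_maxnP score sf0) => f sf max_f; exists f.
Qed.

(** The exchange that refutes optimality: two adjacent leaves form a star of their own, adding a
    centre. *)
Definition detach f u v : {ffun 'I_n -> 'I_n} := reassign (reassign f u u) v u.

Lemma detachE f u v z : detach f u v z = if z == v then u else if z == u then u else f z.
Proof. by rewrite !reassignE. Qed.

Lemma detach_packing f u v : star_packing e m f -> f u != u -> f v != v -> e u v ->
  star_packing e m (detach f u v) /\
  forall z, load (detach f u v) z = load f z - (f u == z) - (f v == z) + (u == z).
Proof.
move=> pf fu fv euv; have [ff ef lf] := star_packingP _ _ _ pf.
have uv : u != v by apply: contraTneq euv => ->; rewrite irr_e.
pose f1 := reassign f u u.
have pf1 : star_packing e m f1.
  by apply: star_packing_reassign => //; [apply: load_eq0 | left].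
have l1 z : load f1 z = load f z - (f u == z).
  rewrite load_reassign; have [<-|] := eqVneq u z; last by rewrite andbT addn0.
  by rewrite (negPf fu) /= addn0.
have f1v : f1 v = f v by rewrite reassignE eq_sym (negPf uv).
split=> [|z].
  apply: star_packing_reassign => //; first by rewrite l1 load_eq0.
  by right; split; rewrite ?l1 ?load_eq0 // ?reassignE ?eqxx // sym_e.
rewrite load_reassign l1 f1v; have [<-|] := eqVneq v z; last by rewrite !andbT.
by rewrite (negPf fv) (negPf uv).
Qed.

Section Optimal.
Variable f : {ffun 'I_n -> 'I_n}.
Hypothesis opt_f : optimal f.

Let sf : star_factor f. Proof. by case: opt_f. Qed.
Let ff x : f (f x) = f x. Proof. by case/star_factorP: sf. Qed.
Let ef x : f x != x -> e x (f x). Proof. by case/star_factorP: sf => ? /(_ x). Qed.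
Let lf y : load f y <= m. Proof. by case/star_factorP: sf. Qed.
Let l_gt0 y : f y = y -> 0 < load f y. Proof. by case/star_factorP: sf => ? ? ? /(_ y). Qed.
Let pf : star_packing e m f. Proof. by case/andP: sf. Qed.

(** By [full_leaves_adj] the edge [a b] forces [k = 1], so the star consists of [w], [a] and [b]
    only, and any of the three could be the centre. *)
Definition triangle w : bool := (f w == w) && (load f w == m) &&
  [exists a, exists b, [&& a \in leaves f w, b \in leaves f w & e a b]].

Lemma optimal_centers g : star_factor g -> #|centers g| <= #|centers f|.
Proof.
case: opt_f => _ max_f /max_f; rewrite /score => le_gf.
have : #|outer_leaves f| <= n by rewrite -[n in _ <= n]card_ord max_card.
move=> le_n; rewrite leqNgt; apply/negP => lt_c.
have : #|centers f|.+1 * n.+1 <= #|centers g| * n.+1 by rewrite leq_mul2r lt_c orbT.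
by rewrite mulSn; lia.
Qed.

(** In all other cases, detaching [u] and [v] leaves every old star with a leaf, and gives a star
    factor with one more centre. *)
Lemma full_leaves_adj u v :
    f u != u -> f v != v -> load f (f u) = m -> load f (f v) = m -> e u v ->
  f u = f v /\ k = 1.
Proof.
move=> fu fv lu lv euv.
have [[-> ->] //|bad] : (f u = f v /\ k = 1) \/ (f u != f v \/ 1 < k).
  by have [|] := eqVneq (f u) (f v); [case: (ltngtP k 1); [lia|right; right|left] | right; left].
have uv : u != v by apply: contraTneq euv => ->; rewrite irr_e.
have [pg lgE] := detach_packing pf fu fv euv; set g := detach f u v in pg lgE.
have [gg eg lg] := star_packingP _ _ _ pg.
have sg : star_factor g.
  apply/star_factorP; split=> // z; rewrite detachE lgE.
  case: (eqVneq z v) => [->|zv]; first by move=> uE; rewrite uE eqxx in uv.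
  have [->|zu] := eqVneq z u; first by rewrite addn1.
  move=> fz; have := l_gt0 fz; rewrite addn0.
  case: (f u =P z) => [fuz|]; case: (f v =P z) => [fvz|] /=; rewrite ?subn0 //.
  - by case: bad => [|k1]; [rewrite fuz fvz eqxx | rewrite -fuz lu -subnDA subn_gt0].
  - by rewrite -fuz lu subn1.
  - by rewrite -fvz lv subn1.
have := optimal_centers sg; suff -> : centers g = u |: centers f.
  by rewrite cardsU1 inE (negPf fu) add1n ltnn.
apply/setP=> z; rewrite !inE detachE.
have [->|zv] := eqVneq z v; first by rewrite [v == u]eq_sym (negPf uv) (negPf fv).
by have [->|zu] := eqVneq z u; rewrite ?eqxx.
Qed.

(** Otherwise detach the adjacent leaves [a] and [b] of [w] and attach [u] to [w]. The former star
    of [u] keeps [k] leaves, and there is one more centre. *)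
Lemma triangle_center_not_adj u w :
    triangle w -> f u != u -> load f (f u) = m -> f u != w -> ~~ e u w.
Proof.
case/andP=> /andP[/eqP fw /eqP lw] /existsP[a /existsP[b /and3P[]]].
rewrite !inE => /andP[aw /eqP fa] /andP[bw /eqP fb] eab fu lu fuw; apply/negP => euw.
have ab : a != b by apply: contraTneq eab => ->; rewrite irr_e.
have ua : u != a by apply: contraNneq fuw => ->; rewrite fa.
have ub : u != b by apply: contraNneq fuw => ->; rewrite fb.
have uw : u != w by apply: contraTneq euw => ->; rewrite irr_e.
have faa : f a != a by rewrite fa eq_sym.
have fua : (f u == a) = false by apply: contraNF faa => /eqP <-; rewrite ff.
have fbb : f b != b by rewrite fb eq_sym.
have [pf2 l2] := detach_packing pf faa fbb eab.
set f2 := detach f a b in pf2 l2; pose g := reassign f2 u w.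
have f2u : f2 u = f u by rewrite detachE (negPf ua) (negPf ub).
have f2w : f2 w = w by rewrite detachE eq_sym (negPf bw) eq_sym (negPf aw).
have pg : star_packing e m g.
  apply: star_packing_reassign => //; first by rewrite l2 load_eq0 // [a == u]eq_sym (negPf ua).
  right; split=> //; first by rewrite eq_sym.
  by rewrite l2 fa fb eqxx (negPf aw) lw addn0 -subnDA ltn_subrL.
have [gg eg lg] := star_packingP _ _ _ pg.
have lgE z : load g z = load f2 z - (f u == z) && (u != z) + (w == z) && (u != z).
  by rewrite load_reassign f2u.
have sg : star_factor g.
  apply/star_factorP; split=> // z; rewrite reassignE lgE l2.
  have [->|zu] := eqVneq z u; first by move=> wu; rewrite wu eqxx in uw.
  rewrite detachE; have [->|zb] := eqVneq z b; first by move=> E; rewrite E eqxx in ab.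
  have [->|za] := eqVneq z a; first by rewrite fua subn0 addn_gt0 addn1.
  move=> fz; have := l_gt0 fz; rewrite fa fb !andbT.
  have [wz|wz] := eqVneq w z; first by rewrite /= addn1.
  rewrite /= !subn0 !addn0; case: (f u =P z) => [fuz|]; rewrite ?subn0 //.
  by rewrite -fuz lu subn1.
have := optimal_centers sg; suff -> : centers g = a |: centers f.
  by rewrite cardsU1 inE (negPf faa) add1n ltnn.
apply/setP=> z; rewrite !inE reassignE detachE.
have [->|zu] := eqVneq z u; first by rewrite (negPf ua) eq_sym (negPf uw) (negPf fu).
have [->|zb] := eqVneq z b; first by rewrite (negPf ab) eq_sym (negPf ab) (negPf fbb).
by have [->|za] := eqVneq z a; rewrite ?eqxx.
Qed.

(** If no leaf of the triangle had an outside neighbour, [w] would have one; making [a] the centre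
    instead would then turn [w] into an additional outer leaf. *)
Lemma triangle_outer w : triangle w ->
  exists u v, [/\ f u = w, u != w, e u v & f v != w].
Proof.
case/andP=> /andP[/eqP fw /eqP lw] /existsP[a /existsP[b /and3P[]]].
rewrite !inE => /andP[aw /eqP fa] /andP[bw /eqP fb] eab.
have ab : a != b by apply: contraTneq eab => ->; rewrite irr_e.
have faa : f a != a by rewrite fa eq_sym.
have fbb : f b != b by rewrite fb eq_sym.
have [_ k1] : f a = f b /\ k = 1.
  by apply: full_leaves_adj; rewrite // ?fa ?fb // eq_sym.
have [/existsP[u /existsP[v /and4P[/eqP ? ? ? ?]]]|/existsPn no_outer] := boolP
  [exists u, exists v, [&& f u == w, u != w, e u v & f v != w]]; first by exists u, v.
have inner u v : f u = w -> u != w -> e u v -> f v = w.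
  move=> fu uw euv; have /existsPn/(_ v) := no_outer u.
  by rewrite fu eqxx uw euv negbK => /eqP.
pose C := [set z | f z == w].
have leavesE : leaves f w = [set a; b].
  apply/esym/eqP; rewrite eqEcard cards2 ab; apply/andP; split; last by rewrite -/(load f w) lw /m k1.
  by apply/subsetP=> z; rewrite !inE => /orP[] /eqP->; rewrite ?aw ?bw ?fa ?fb eqxx.
have CE z : f z = w -> [\/ z = w, z = a | z = b].
  move=> fz; have [->|zw] := eqVneq z w; first by constructor 1.
  have : z \in leaves f w by rewrite inE zw fz eqxx.
  by rewrite leavesE !inE => /orP[]/eqP->; [constructor 2|constructor 3].
(* By connectedness, a triangle without outside neighbours would be the whole graph, which has more
   than three vertices. *)
have [v ewv fv] : exists2 v, e w v & f v != w.
  apply/exists_inP; apply: contraTT n_gt3 => /exists_inPn no_v.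
  have closedC : closed e C.
    apply: intro_closed => [|x y exy]; first exact/sym_connect_sym.
    rewrite !inE => /eqP fx; have [xw|xw] := eqVneq x w.
      by have := no_v y; rewrite negbK; apply; rewrite xw in exy.
    by rewrite (inner x y).
  have CT : C = setT.
    apply/setP=> z; rewrite [RHS]inE.
    by rewrite -(closed_connect closedC (conn_e w z)) inE fw eqxx.
  have : #|C| <= #|[set w; a; b]|.
    by apply/subset_leq_card/subsetP=> z; rewrite !inE => /eqP/CE[]->; rewrite eqxx ?orbT.
  rewrite CT cardsT card_ord -leqNgt => /leq_trans; apply.
  by rewrite setUC cardsU1 cards2; case: (_ \notin _); case: (_ != _).
have wa : w != a by rewrite eq_sym.
have wb : w != b by rewrite eq_sym.
have [pf2 l2] := detach_packing pf faa fbb eab.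
set f2 := detach f a b in pf2 l2; pose g := reassign f2 w a.
have f2w : f2 w = w by rewrite detachE (negPf wa) (negPf wb).
have f2a : f2 a = a by rewrite detachE (negPf ab) eqxx.
have l2w : load f2 w = 0 by rewrite l2 fa fb eqxx (negPf aw) lw /m k1.
have l2a : load f2 a = 1.
  by rewrite l2 fa fb eqxx (negPf wa) load_eq0.
have pg : star_packing e m g.
  apply: star_packing_reassign => //; right; split=> //.
    by rewrite -fa sym_e; apply: ef.
  by rewrite l2a /m k1.
have gE z : g z = if f z == w then a else f z.
  rewrite reassignE detachE; have [->|zw] := eqVneq z w; first by rewrite fw eqxx.
  have [->|zb] := eqVneq z b; first by rewrite fb eqxx.
  have [->|za] := eqVneq z a; first by rewrite fa eqxx.
  by case: eqP => // /CE[] E; [rewrite E eqxx in zw|rewrite E eqxx in za|rewrite E eqxx in zb].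
have [gg eg lg] := star_packingP _ _ _ pg.
have sg : star_factor g.
  apply/star_factorP; split=> // z; rewrite gE load_reassign f2w l2.
  case: (f z =P w) => [_ <-|fzw fz].
    by rewrite eqxx wa addn_gt0 orbT.
  have zw : w != z by apply: contra_not_neq fzw => <-.
  by rewrite fa fb (negPf zw) !subn0 !addn_gt0 l_gt0.
case: opt_f => _ /(_ g sg); rewrite leqNgt => /negP[].
have cg : #|centers g| = #|centers f|.
  have -> : centers g = a |: (centers f :\ w).
    apply/setP=> z; rewrite !inE gE; have [->|za] := eqVneq z a.
      by rewrite fa !eqxx.
    case: (f z =P w) => [fz|fz]; last first.
      by rewrite andb_idl // => _; apply: contra_not_neq fz => ->.
    rewrite [a == z]eq_sym (negPf za); have [//|zw] := eqVneq z w.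
    by rewrite fz eq_sym (negPf zw).
  rewrite cardsU1 !inE (negPf faa) andbF [RHS](cardsD1 w) inE fw eqxx //.
rewrite /score cg ltn_add2l; apply: proper_card; apply/properP; split; last first.
  exists w; last by rewrite inE fw eqxx.
  rewrite inE gE fw eqxx eq_sym wa; apply/existsP; exists v.
  rewrite ewv gE (negPf fv); apply/negP => /eqP fva.
  by have := ff v; rewrite fva fa => E; rewrite E eqxx in wa.
(* No outer leaf is lost: by [inner] neither leaf of the old star was outer. *)
apply/subsetP=> z; rewrite !inE => /andP[fz /existsP[y /andP[ezy fy]]].
have fzw : f z != w.
  apply/negP => /eqP fzw; rewrite fzw in fz fy.
  by rewrite (inner z y) // ?eqxx 1?eq_sym // in fy.
rewrite gE (negPf fzw) fz; apply/existsP; exists y; rewrite ezy gE.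
case: ifP => // _; apply/negP => /eqP aE.
by have := ff z; rewrite -aE fa => E; rewrite E eqxx in wa.
Qed.

(** * Linking the full stars *)

Definition star_edge : rel 'I_n := fun x y => (x != y) && ((f x == y) || (f y == x)).

(* [b] is a forest containing all the stars, whose other edges link stars
   inside [X]; every full star inside [X] has a leaf which is not a leaf
   of [b]. *)
Definition linking_forest (X : {set 'I_n}) (b : rel 'I_n) : Prop :=
  [/\ forall x, (f x \in X) = (x \in X),
      forall x, load f (f x) < m -> x \in X,
      [/\ symmetric b, subrel b e & acyclic b],
      subrel star_edge b /\
        forall x y, b x y -> star_edge x y \/ x \in X /\ y \in X
    & forall y, f y = y -> y \in X -> load f y = m ->
        exists2 u, u \in leaves f y & exists2 z, z != y & b u z].

Lemma star_edge_sym : symmetric star_edge.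
Proof. by move=> x y; rewrite /star_edge eq_sym orbC. Qed.

Lemma star_edge_center x y : star_edge x y -> f x = f y.
Proof. by case/andP=> _ /orP[] /eqP <-. Qed.

Lemma star_edge_leaf x y : f x != x -> star_edge x y -> y = f x.
Proof.
by move=> fx /andP[_ /orP[/eqP //|/eqP fy]]; rewrite -fy ff eqxx in fx.
Qed.

Lemma star_edge_sub : subrel star_edge e.
Proof.
move=> x y /andP[xy /orP[] /eqP E]; last rewrite sym_e.
  by rewrite -E ef // E eq_sym.
by rewrite -E ef // E.
Qed.

Lemma acyclic_stars : acyclic star_edge.
Proof.
apply: (acyclic_pendant star_edge_sym) => x y xy.
have [fx|fx] := eqVneq (f x) x; [right|left] => z.
  have fy : f y != y.
    case/andP: xy => xy /orP[|/eqP->] //; first by rewrite fx (negPf xy).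
  by move/(star_edge_leaf fy) => ->; apply/esym/star_edge_leaf; rewrite // star_edge_sym.
by rewrite (star_edge_leaf fx xy); apply: star_edge_leaf.
Qed.

(** Stars that are not full are harmless, so they make up the initial [X]. *)
Lemma linking_forest_init : linking_forest [set x | load f (f x) < m] star_edge.
Proof.
split=> [x|x|||y fy]; rewrite ?inE ?ff //.
- by split; [apply: star_edge_sym|apply: star_edge_sub|apply: acyclic_stars].
- by split=> // x y; left.
- by rewrite fy => ly E; rewrite E ltnn in ly.
Qed.

(** Before the edge is added, the star of [u] is a union of components of [b] disjoint from [X], so
    no cycle arises. Afterwards [u] itself is the leaf with a second neighbour, namely [z]. *)
Lemma linking_forest_add X b u z : linking_forest X b ->
    u \notin X -> f u != u -> z \in X -> e u z ->
  linking_forest (X :|: [set v | f v == f u]) (add_edge b u z).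
Proof.
move=> [fX nfX [sym_b sub_b acyc_b] [star_b b_star] cert] uX fu zX euz.
pose C := [set v | f v == f u].
have CX v : v \in C -> v \notin X by rewrite inE -fX => /eqP->; rewrite fX.
have sub_b' : subrel b (add_edge b u z) by move=> x y bxy; rewrite /add_edge bxy.
split=> [x|x /nfX xX|||y fy].
- by rewrite !inE ff fX.
- by rewrite inE xX.
- split; first exact: add_edge_sym.
    move=> x y /or3P[/sub_b //|/andP[/eqP-> /eqP->] //|/andP[/eqP-> /eqP->]].
    by rewrite sym_e.
  apply: acyclic_add_edge => //; apply/negP => uz.
  have closedC : closed b C.
    apply: intro_closed => [|x y bxy xC]; first exact/sym_connect_sym.
    case: (b_star _ _ bxy) => [/star_edge_center xy|[xX _]].
      by rewrite inE -xy; rewrite inE in xC.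
    by have := CX x xC; rewrite xX.
  have := closed_connect closedC uz; rewrite !inE eqxx => /esym zC.
  by have := CX z; rewrite inE zC zX => /(_ isT).
- split=> [x y /star_b/sub_b' //|x y].
  have uC : u \in C by rewrite inE.
  case/or3P=> [/b_star[]|/andP[/eqP-> /eqP->]|/andP[/eqP-> /eqP->]]; first by left.
  + by case=> xX yX; right; rewrite !in_setU xX yX.
  + by right; rewrite !in_setU uC zX orbT.
  + by right; rewrite !in_setU uC zX orbT.
- rewrite in_setU => /orP[yX ly|].
    have [v vl [w wy bvw]] := cert y fy yX ly.
    by exists v => //; exists w => //; apply: sub_b'.
  rewrite inE fy => /eqP yE ly; exists u; first by rewrite inE yE eq_sym fu eqxx.
  exists z; last by rewrite /add_edge !eqxx orbT.
  by apply: contraTneq zX => ->; rewrite yE fX.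
Qed.

(** Suppose no leaf outside [X] is adjacent to [X]. For the centres [S] outside [X] that are not
    triangles, every neighbour of one of their leaves is again in [S], so [S] violates the strict
    hypothesis unless empty. *)
Lemma linking_forest_grow X b :
    (forall S : {set 'I_n}, S != set0 -> #|isolated e S| < m * #|S|) ->
    linking_forest X b -> X != setT ->
  exists u, exists2 z, z \in X & [/\ u \notin X, f u != u & e u z].
Proof.
move=> few_iso [fX nfX _ _ _] XT.
have [/existsP[u /existsP[z /and4P[zX uX fu euz]]]|/existsPn no_link] := boolP
  [exists u, exists z, [&& z \in X, u \notin X, f u != u & e u z]].
  by exists u; exists z.
have out u z : u \notin X -> f u != u -> e u z -> z \notin X.
  by move=> uX fu euz; have /existsPn/(_ z) := no_link u; rewrite uX fu euz !andbT.
have full x : x \notin X -> load f (f x) = m.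
  by move=> xX; apply/eqP; rewrite eqn_leq lf leqNgt; apply: contra xX; apply: nfX.
pose S := [set y | [&& f y == y, y \notin X & ~~ triangle y]].
have S_leaves : [set z | (f z != z) && (f z \in S)] \subset isolated e S.
  apply/subsetP=> z; rewrite inE => /andP[fz fzS].
  have := fzS; rewrite inE ff eqxx fX /= => /andP[zX ntri].
  rewrite !inE (negPf fz) /=; apply/forallP=> y; apply/implyP=> ezy.
  have yX := out z y zX fz ezy.
  have fy : f y = y.
    apply/eqP/negPn/negP => fy.
    have [fzy _] := full_leaves_adj fz fy (full z zX) (full y yX) ezy.
    case/negP: ntri; rewrite /triangle ff eqxx full // eqxx /=.
    by apply/existsP; exists z; apply/existsP; exists y; rewrite !inE ezy fzy eqxx -{1}fzy !(eq_sym _ (f _)) fz fy.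
  rewrite inE fy eqxx yX /=; apply/negP => tri_y.
  have fzy : f z != y by apply: contraNneq ntri => ->.
  by have := triangle_center_not_adj tri_y fz (full z zX) fzy; rewrite ezy.
have S0 : S = set0.
  apply/eqP/negPn/negP => /few_iso; rewrite ltnNge => /negP[].
  apply: leq_trans (subset_leq_card S_leaves); rewrite -sum_load.
  rewrite (eq_bigr (fun=> m)) ?sum_nat_const 1?mulnC // => y.
  by rewrite inE => /and3P[/eqP fy yX _]; rewrite -{1}fy full.
have tri x : f x = x -> x \notin X -> triangle x.
  move=> fx xX; apply/negPn/negP => ntri.
  by have : x \in S by [rewrite inE fx eqxx xX]; rewrite S0 inE.
have [x xX] : exists x, x \notin X.
  by apply/existsP; apply: contraR XT => /existsPn h; apply/eqP/setP=> x; rewrite inE; apply/negPn/h.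
(* Only triangles remain outside [X]. The edge leaving one of them ends outside [X], at a centre or
   at a leaf of another triangle, and both are excluded. *)
have [u [v [fu uw euv fv]]] := triangle_outer (tri (f x) (ff x) (etrans (congr1 negb (fX x)) xX)).
have uX : u \notin X by rewrite -fX fu fX.
have fuu : f u != u by rewrite fu eq_sym.
have vX := out u v uX fuu euv.
have [fvv|fvv] := eqVneq (f v) v.
  have fuv : f u != v by rewrite fu -fvv eq_sym.
  by have := triangle_center_not_adj (tri v fvv vX) fuu (full u uX) fuv; rewrite euv.
have [fuv _] := full_leaves_adj fuu fvv (full u uX) (full v vX) euv.
by rewrite -fuv fu eqxx in fv.
Qed.

Lemma linking_forest_total :
    (forall S : {set 'I_n}, S != set0 -> #|isolated e S| < m * #|S|) ->
  exists b, linking_forest setT b.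
Proof.
move=> few_iso.
suff grow N X b : #|~: X| < N -> linking_forest X b -> exists b', linking_forest setT b'.
  exact: grow (ltnSn _) linking_forest_init.
elim: N X b => // N IHN X b ltN forest_b.
have [XT|XT] := eqVneq X setT; first by exists b; rewrite -XT.
have [u [z zX [uX fu euz]]] := linking_forest_grow few_iso forest_b XT.
apply: IHN _ (linking_forest_add forest_b uX fu zX euz).
rewrite ltnS in ltN; apply: leq_trans ltN; apply: proper_card; apply/properP; split.
  by rewrite setCS subsetUl.
by exists u; rewrite !inE ?eqxx ?orbT.
Qed.

(** A leaf of [t] has a single neighbour, and [t] contains all star edges, so that neighbour is its
    partner in its star. A full star loses one leaf by the certificate. *)
Lemma linking_forest_leaf_degree b t :
    linking_forest setT b -> subrel b t -> subrel t e -> symmetric t ->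
  leaf_degree t <= k.
Proof.
move=> [_ _ [sym_b _ _] [star_b _] cert] sub_t sub_e sym_t.
apply/bigmax_leqP => y _; rewrite /leaf_deg_vertex.
have leafP u : is_leaf t u -> forall v w, t u v -> t u w -> v = w.
  move=> /cards1P[v0 E] v w tuv tuw.
  have : v \in [set v0] by rewrite -E inE.
  have : w \in [set v0] by rewrite -E inE.
  by rewrite !inE => /eqP-> /eqP->.
have t_star x : f x != x -> t x (f x).
  by move=> fx; apply/sub_t/star_b; rewrite /star_edge eq_sym fx eqxx.
have leaf_center u : t y u -> is_leaf t u -> if f u == u then f y = u else f u = y.
  rewrite sym_t => tuy lu; case: ifPn => [/eqP fu|fu].
    have /card_gt0P[v] := l_gt0 fu; rewrite inE => /andP[vu /eqP fv].
    have tuv : t u v by rewrite sym_t -fv t_star // fv eq_sym.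
    by rewrite (leafP u lu y v).
  by rewrite (leafP u lu (f u) y) // t_star.
have [fy|fy] := eqVneq (f y) y; last first.
  (* A vertex that is not a centre can only have its own centre as an adjacent leaf, and
     [1 <= k]. *)
  apply: (@leq_trans 1) => //; rewrite -(cards1 (f y)); apply/subset_leq_card/subsetP=> u.
  rewrite !inE => /andP[tyu lu]; have := leaf_center u tyu lu.
  by case: ifP => [_ ->|_ fu] //; rewrite -fu ff fu eqxx in fy.
have sub_leaves : [set u | t y u & is_leaf t u] \subset leaves f y.
  apply/subsetP=> u; rewrite !inE => /andP[tyu lu].
  have uy : u != y by apply: contraTneq (sub_e _ _ tyu) => ->; rewrite irr_e.
  have := leaf_center u tyu lu; case: ifP => [_ E|_ ->]; last by rewrite eqxx uy.
  by rewrite -E fy eqxx in uy.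
have [ly|ly] := eqVneq (load f y) m; last first.
  apply: leq_trans (subset_leq_card sub_leaves) _.
  by rewrite -ltnS ltn_neqAle ly lf.
have [u ul [z zy buz]] := cert y fy (in_setT y) ly.
rewrite -ltnS -[k.+1]ly; apply: proper_card; apply/properP; split=> //.
exists u => //; rewrite inE; apply/negP => /andP[tyu lu].
by rewrite (leafP u lu z y (sub_t _ _ buz)) ?eqxx // sym_t in zy.
Qed.

End Optimal.

Theorem spanning_tree_leaf_degree :
    (forall S : {set 'I_n}, S != set0 -> #|isolated e S| < m * #|S|) ->
  exists t : rel 'I_n, spanning_tree e t /\ leaf_degree t <= k.
Proof.
move=> few_iso; have [f opt_f] := optimal_exists (fun S S0 => ltnW (few_iso S S0)).
have [b forest_b] := linking_forest_total opt_f few_iso.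
have [_ _ [sym_b sub_b acyc_b] _ _] := forest_b.
have [t tree_t sub_t] := spanning_tree_extend conn_e sym_e sym_b sub_b acyc_b.
exists t; split=> //; have [sym_t [sub_te _]] := tree_t.
exact: linking_forest_leaf_degree opt_f _ _ forest_b sub_t sub_te sym_t.
Qed.

End OptimalFactor.

(** * Spectral radius and Perron vectors *)

Import Order.TTheory GRing.Theory Num.Theory.
Local Open Scope ring_scope.

Lemma mem_eigen_seq n (A : 'M[algC]_n) z :
  (z \in eigen_seq A) = eigenvalue A z.
Proof.
rewrite eigenvalue_root_char /eigen_seq; case: closed_field_poly_normal => s /= ->.
by rewrite rootZ ?root_prod_XsubC // (monicP (char_poly_monic A)) oner_eq0.
Qed.

Lemma bigmax_norm_ge0 (s : seq algC) : 0 <= \big[Num.max/0]_(w <- s) `|w| :> algC.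
Proof.
elim: s => [|w s IHs]; first by rewrite big_nil.
by rewrite big_cons comparable_le_max ?normr_ge0 // real_comparable ?normr_real ?ger0_real.
Qed.

Lemma le_bigmax_norm (s : seq algC) z :
  z \in s -> `|z| <= \big[Num.max/0]_(w <- s) `|w|.
Proof.
elim: s => [//|w s IHs]; rewrite inE big_cons.
rewrite comparable_le_max ?real_comparable ?normr_real ?ger0_real ?bigmax_norm_ge0 //.
by case/predU1P=> [->|/IHs ->]; rewrite ?lexx ?orbT.
Qed.

Lemma bigmax_norm_attained (s : seq algC) : s != [::] ->
  exists2 z, z \in s & \big[Num.max/0]_(w <- s) `|w| = `|z|.
Proof.
elim: s => [//|w s IHs] _; rewrite big_cons.
have [->|/IHs[z zs ->]] := eqVneq s [::].
  exists w; rewrite ?mem_head // big_nil.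
  by rewrite max_l ?normr_ge0.
have [le|lt] := real_leP (normr_real w) (normr_real z).
  by exists z; rewrite ?inE ?zs ?orbT.
by exists w; rewrite ?mem_head.
Qed.

(** * Rayleigh quotients of real symmetric matrices *)

Section Rayleigh.
Variables (n : nat) (A : 'M[algC]_n).
Hypotheses (Areal : A \is a mxOver Num.real) (Asym : A \is symmetricmx).
Local Open Scope sesquilinear_scope.

Let P := spectralmx A.
Let D := spectral_diag A.

Lemma sym_spectralE : A = P^t* *m diag_mx D *m P.
Proof.
rewrite -invmx_unitary ?spectral_unitarymx //.
exact/orthomx_spectralP/symmetric_normalmx.
Qed.

(** The rows of [P] are eigenvectors for the entries of [D], which are real and hence at most their
    moduli. *)
Lemma spectral_diag_le i : D 0 i <= spectral_radius A.
Proof.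
have Pu : P *m P^t* = 1%:M by apply/unitarymxP/spectral_unitarymx.
have eigD : eigenvalue A (D 0 i).
  apply/eigenvalueP; exists (row i P).
    rewrite [in LHS]sym_spectralE !mulmxA -!row_mul Pu mul1mx.
    by apply/rowP=> j; rewrite row_mul row_diag_mx -scalemxAl -rowE !mxE.
  apply: contraTneq isT => /(congr1 (fun v => v *m P^t*)).
  rewrite -row_mul Pu mul0mx => /rowP/(_ i)/eqP; rewrite !mxE eqxx.
  by rewrite oner_eq0.
rewrite -mem_eigen_seq in eigD; apply: le_trans (le_bigmax_norm eigD).
apply: real_ler_norm.
by have /mxOverP := hermitian_spectral_diag_real (realsym_hermsym Asym Areal); apply.
Qed.

Let u (v : 'rV_n) := v *m P^t*.

Lemma sqnorm_spectral (v : 'rV_n) :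
  (v *m v^t*) 0 0 = \sum_i `|u v 0 i| ^+ 2.
Proof.
have -> : v *m v^t* = u v *m (u v)^t*.
  rewrite /u trmx_mul map_mxM trmxCK mulmxA mulmxKtV //.
  by rewrite spectral_unitarymx.
by rewrite mxE; apply: eq_bigr => i _; rewrite !mxE normCK.
Qed.

Lemma quad_spectral (v : 'rV_n) :
  (v *m A *m v^t*) 0 0 = \sum_i D 0 i * `|u v 0 i| ^+ 2.
Proof.
have -> : v *m A *m v^t* = u v *m diag_mx D *m (u v)^t*.
  by rewrite /u [A in LHS]sym_spectralE trmx_mul map_mxM trmxCK !mulmxA.
rewrite mxE; apply: eq_bigr => i _.
by rewrite mul_mx_diag !mxE normCK mulrAC mulrC.
Qed.

Lemma rayleigh_le (v : 'rV_n) :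
  (v *m A *m v^t*) 0 0 <= spectral_radius A * (v *m v^t*) 0 0.
Proof.
rewrite quad_spectral sqnorm_spectral mulr_sumr; apply: ler_sum => i _.
by rewrite ler_wpM2r ?exprn_ge0 // spectral_diag_le.
Qed.

(** In spectral coordinates the difference of the two sides is a sum of nonnegative terms, so each
    coordinate of [v] vanishes or belongs to the top eigenvalue. *)
Lemma rayleigh_eq (v : 'rV_n) :
  (v *m A *m v^t*) 0 0 = spectral_radius A * (v *m v^t*) 0 0 ->
  v *m A = spectral_radius A *: v.
Proof.
move/eqP; rewrite quad_spectral sqnorm_spectral eq_sym -subr_eq0.
rewrite mulr_sumr -sumrB psumr_eq0 => [/allP u0|i _]; last first.
  by rewrite -mulrBl mulr_ge0 ?exprn_ge0 // subr_ge0 spectral_diag_le.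
have uD : u v *m diag_mx D = spectral_radius A *: u v.
  apply/rowP=> i; rewrite mul_mx_diag [LHS]mxE [RHS]mxE.
  have := u0 i (mem_index_enum _); rewrite -mulrBl mulf_eq0 subr_eq0.
  case/orP=> [/eqP<-|]; first by rewrite mulrC.
  by rewrite expf_eq0 normr_eq0 => /eqP->; rewrite mul0r mulr0.
rewrite [A in LHS]sym_spectralE !mulmxA -/(u v) uD -scalemxAl /u mulmxKtV //.
by rewrite spectral_unitarymx.
Qed.

End Rayleigh.

Lemma rho_real n (e : rel 'I_n) : rho e \is Num.real.
Proof. exact/ger0_real/bigmax_norm_ge0. Qed.

(** * Test vectors and Perron vectors of graphs *)

Section GraphSpectrum.
Variables (n : nat) (e : rel 'I_n).
Hypothesis sym_e : symmetric e.

Lemma adj_real : adj e \is a mxOver Num.real.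
Proof. by apply/mxOverP=> i j; rewrite mxE realn. Qed.

Lemma adj_sym : adj e \is symmetricmx.
Proof. by apply/is_hermitianmxP; rewrite expr0 scale1r map_mx_id //; apply/matrixP=> i j; rewrite !mxE sym_e. Qed.

Let quad (w : 'I_n -> algC) := \sum_j (\sum_i w i * (e i j)%:R) * w j.

Local Open Scope sesquilinear_scope.

Lemma row_quad (w : 'I_n -> algC) (v := \row_i w i) : (forall i, 0 <= w i) ->
  (v *m adj e *m v^t*) 0 0 = quad w /\ (v *m v^t*) 0 0 = \sum_i w i ^+ 2.
Proof.
move=> w_ge0; have wC i : (w i)^* = w i by apply/CrealP/ger0_real.
split; rewrite mxE; apply: eq_bigr => i _; rewrite !mxE wC ?expr2 //.
by congr (_ * _); apply: eq_bigr => j _; rewrite !mxE.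
Qed.

Lemma quad_le_rho (w : 'I_n -> algC) : (forall i, 0 <= w i) ->
  quad w <= rho e * \sum_i w i ^+ 2.
Proof. by move=> /row_quad[<- <-]; apply/rayleigh_le/adj_sym/adj_real. Qed.

(** Pairing the entrywise inequality with [w] bounds the Rayleigh quotient of [w] from below by
    [x]. *)
Lemma le_rho (w : 'I_n -> algC) (x : algC) (j0 : 'I_n) :
    (forall i, 0 <= w i) -> 0 < w j0 ->
    (forall j, x * w j <= \sum_i w i * (e i j)%:R) ->
  x <= rho e.
Proof.
move=> w_ge0 w0 le_xw.
have W_gt0 : 0 < \sum_i w i ^+ 2.
  rewrite (bigD1 j0) //= ltr_wpDr ?exprn_gt0 //.
  by apply: sumr_ge0 => i _; rewrite exprn_ge0.
rewrite -(ler_pM2r W_gt0); apply: le_trans (quad_le_rho w_ge0).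
by rewrite mulr_sumr; apply: ler_sum => j _; rewrite expr2 mulrA ler_wpM2r.
Qed.

Lemma lt_rho (w : 'I_n -> algC) (x : algC) (j0 : 'I_n) :
    (forall i, 0 <= w i) -> 0 < w j0 ->
    (forall j, x * w j <= \sum_i w i * (e i j)%:R) ->
    x * w j0 < \sum_i w i * (e i j0)%:R ->
  x < rho e.
Proof.
move=> w_ge0 w0 le_xw lt_xw.
have W_gt0 : 0 < \sum_i w i ^+ 2.
  rewrite (bigD1 j0) //= ltr_wpDr ?exprn_gt0 //.
  by apply: sumr_ge0 => i _; rewrite exprn_ge0.
rewrite -(ltr_pM2r W_gt0); apply: lt_le_trans (quad_le_rho w_ge0).
rewrite mulr_sumr /quad (bigD1 j0) //= [ltRHS](bigD1 j0) //=.
apply: ltr_leD; first by rewrite expr2 mulrA ltr_pM2r.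
by apply: ler_sum => j _; rewrite expr2 mulrA ler_wpM2r.
Qed.

(** Take the moduli of an eigenvector whose eigenvalue has modulus [rho e]. By the triangle
    inequality they attain the Rayleigh bound, so [rayleigh_eq] applies. *)
Lemma perron_nonneg : (0 < n)%N -> exists y : 'I_n -> algC,
  [/\ forall i, 0 <= y i, exists i, y i != 0 &
      forall j, \sum_i y i * (e i j)%:R = rho e * y j].
Proof.
move=> n_gt0.
have es_neq0 : eigen_seq (adj e) != [::].
  have [a] := eigenvalue_closed (adj e) n_gt0.
  by rewrite -mem_eigen_seq; case: eigen_seq.
have [z zA rhoE] := bigmax_norm_attained es_neq0.
have {rhoE} rhoE : rho e = `|z| by [].
rewrite mem_eigen_seq in zA; have /eigenvalueP[v vA v_neq0] := zA.
pose y i := `|v 0 i|; have y_ge0 i : 0 <= y i by rewrite normr_ge0.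
exists y; split=> //.
  by case/rV0Pn: v_neq0 => i vi; exists i; rewrite normr_eq0.
have [qE sE] := row_quad y_ge0.
have colE j : \sum_i v 0 i * (e i j)%:R = z * v 0 j.
  by have /rowP/(_ j) := vA; rewrite !mxE => <-; apply: eq_bigr => i _; rewrite mxE.
have quadE : quad y = rho e * \sum_i y i ^+ 2.
  apply/eqP; rewrite eq_le quad_le_rho //= mulr_sumr; apply: ler_sum => j _.
  rewrite expr2 mulrA ler_wpM2r // rhoE /y -normrM -colE.
  apply: le_trans (ler_norm_sum _ _ _) _.
  by apply: ler_sum => i _; rewrite normrM normr_nat.
rewrite -sE -qE in quadE; have := rayleigh_eq adj_real adj_sym quadE.
move=> yA j; have /rowP/(_ j) := yA; rewrite !mxE => <-.
by apply: eq_bigr => i _; rewrite !mxE.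
Qed.

(** At a zero of [y] the eigenvalue equation makes all neighbours zero, so by connectedness the
    support is everything. *)
Lemma perron : (0 < n)%N -> gconnected e -> exists y : 'I_n -> algC,
  (forall i, 0 < y i) /\ forall j, \sum_i y i * (e i j)%:R = rho e * y j.
Proof.
move=> n_gt0 conn_e; have [y [y_ge0 [i0 yi0] yE]] := perron_nonneg n_gt0.
exists y; split=> // i; rewrite lt0r y_ge0 andbT.
have closed0 : closed e [pred i | y i != 0].
  apply: intro_closed => [|a b eab]; first exact/sym_connect_sym.
  apply: contra => /= /eqP yb; have /eqP := yE b; rewrite yb mulr0.
  rewrite psumr_eq0 => [/allP/(_ a (mem_index_enum _))|c _].
    by rewrite eab mulr1.
  by rewrite mulr_ge0 ?ler0n.
have := closed_connect closed0 (conn_e i i0); rewrite !inE => ->.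
by [].
Qed.

End GraphSpectrum.

(** * Comparison with the extremal graph *)

Lemma rho_isomorphic n (e1 e2 : rel 'I_n) : (0 < n)%N ->
  symmetric e1 -> symmetric e2 -> isomorphic e1 e2 -> rho e1 <= rho e2.
Proof.
move=> n_gt0 sym1 sym2 [f [[g fK gK] ef]].
have [y [y_ge0 [i0 yi0] yE]] := perron_nonneg sym1 n_gt0.
apply: (@le_rho _ _ sym2 (y \o g) _ (f i0)) => [i||j] /=; first exact: y_ge0.
  by rewrite fK lt0r yi0 y_ge0.
rewrite (reindex f) /=; last by exists g => i _; [apply: fK | apply: gK].
rewrite -yE le_eqVlt; apply/orP; left; apply/eqP; apply: eq_bigr => i _.
by rewrite fK ef gK.
Qed.

(* [K_S \/ (K_B + I_J)], where [B] is the complement of [S :|: J]. *)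
Definition block_graph n (S J : {set 'I_n}) : rel 'I_n :=
  fun i j => (i != j) &&
    [|| i \in S, j \in S | (i \notin J) && (j \notin J)].

(** Vectors constant on the three cells of an equitable partition, normalised to 1 on [S]. *)
Definition block_vector n (S J : {set 'I_n}) (b c : algC) (i : 'I_n) : algC :=
  if i \in S then 1 else if i \in J then c else b.

Section BlockGraph.
Variables (n : nat) (S J : {set 'I_n}).
Hypothesis disjSJ : [disjoint S & J].

Lemma block_sym : symmetric (block_graph S J).
Proof.
by move=> i j; rewrite /block_graph eq_sym orbCA [(i \notin J) && _]andbC.
Qed.

Lemma card_blocks : (#|S| + #|J| + #|~: (S :|: J)| = n)%N.
Proof.
have := cardsC (S :|: J); rewrite card_ord cardsU.
by move: disjSJ; rewrite -setI_eq0 => /eqP->; rewrite cards0 subn0.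
Qed.

Let r := #|~: (S :|: J)|.

Lemma block_row_sum b c j :
  \sum_i block_vector S J b c i * (block_graph S J i j)%:R =
  if j \in S then #|S|%:R - 1 + r%:R * b + #|J|%:R * c
  else if j \in J then #|S|%:R else #|S|%:R + (r%:R - 1) * b.
Proof.
pose w := block_vector S J b c.
have SJ i : i \in S -> (i \in J) = false by apply: disjointFr.
have sumS : \sum_(i in S) w i = #|S|%:R.
  by rewrite -sumr_const; apply: eq_bigr => i iS; rewrite /w /block_vector iS.
have sumJ : \sum_(i in J) w i = #|J|%:R * c.
  rewrite mulr_natl -sumr_const; apply: eq_bigr => i iJ.
  by rewrite /w /block_vector iJ (disjointFl disjSJ).
have sumB : \sum_(i in ~: (S :|: J)) w i = r%:R * b.
  rewrite mulr_natl -sumr_const; apply: eq_bigr => i.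
  by rewrite !inE negb_or /w /block_vector => /andP[/negPf-> /negPf->].
have sumSB : \sum_(i | i \notin J) w i = #|S|%:R + r%:R * b.
  rewrite (bigID (mem S)) /= -sumS -sumB; congr (_ + _); apply: eq_bigl => i.
    by rewrite andb_idl // => /SJ->.
  by rewrite !inE negb_or andbC.
have sum_all : \sum_i w i = #|S|%:R + r%:R * b + #|J|%:R * c.
  by rewrite (bigID (mem J)) /= sumSB sumJ addrC.
have sum_cond (Q : pred 'I_n) : (forall i, block_graph S J i j = Q i) ->
    \sum_i w i * (block_graph S J i j)%:R = \sum_(i | Q i) w i.
  move=> eQ; rewrite [RHS]big_mkcond; apply: eq_bigr => i _.
  by rewrite eQ; case: (Q i); rewrite ?mulr1 ?mulr0.
case: ifPn => [jS|jNS]; last case: ifPn => [jJ|jNJ].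
- rewrite (sum_cond [pred i | i != j]) => [|i]; last first.
    by rewrite /block_graph jS orbT andbT.
  have := sum_all; rewrite (bigD1 j) //= {1}/w /block_vector jS => sumE.
  by apply: (addrI 1); rewrite sumE; ring.
- rewrite (sum_cond (mem S)) // => i.
  rewrite /block_graph jJ (negPf jNS) andbF !orbF /= andb_idl // => iS.
  by apply: contraNneq jNS => <-.
- rewrite (sum_cond [pred i | (i \notin J) && (i != j)]) => [|i]; last first.
    rewrite /block_graph (negPf jNS) jNJ andbT /= andbC; congr (_ && _).
    by case iS: (i \in S) => //=; rewrite ?SJ.
  have := sumSB; rewrite (bigD1 j) //= {1}/w /block_vector (negPf jNS) (negPf jNJ) => sumE.
  by apply: (addrI b); rewrite sumE; ring.
Qed.

End BlockGraph.

(** List the vertices of [S], then of [J], then the others. The position in the list determines the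
    block, so matching positions is an isomorphism. *)
Lemma block_isomorphic n (S J S' J' : {set 'I_n}) :
    [disjoint S & J] -> [disjoint S' & J'] -> #|S| = #|S'| -> #|J| = #|J'| ->
  isomorphic (block_graph S J) (block_graph S' J').
Proof.
pose L (A B : {set 'I_n}) := enum A ++ enum B ++ enum (~: (A :|: B)).
have memL (A B : {set _}) x : x \in L A B.
  by rewrite !mem_cat !mem_enum !inE; case: (x \in A); case: (x \in B).
have sizeL (A B : {set _}) : [disjoint A & B] -> size (L A B) = n.
  by move=> dAB; rewrite !size_cat -!cardE addnA card_blocks.
have uniqL (A B : {set _}) : [disjoint A & B] -> uniq (L A B).
  move=> dAB; apply: (leq_size_uniq (enum_uniq 'I_n)) => [x _|]; first exact: memL.
  by rewrite sizeL // -cardE card_ord.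
have indexS (A B : {set _}) x : [disjoint A & B] -> (x \in A) = (index x (L A B) < #|A|)%N.
  move=> dAB; rewrite index_cat mem_enum cardE; case: ifP => [xA|_].
    by rewrite index_mem mem_enum.
  by rewrite ltnNge leq_addr.
have indexSJ (A B : {set _}) x : [disjoint A & B] ->
    (x \in A) || (x \in B) = (index x (L A B) < #|A| + #|B|)%N.
  move=> dAB; rewrite index_cat mem_enum; case: ifP => [xA|_] /=.
    by rewrite ltn_addr // cardE index_mem mem_enum.
  rewrite -cardE ltn_add2l index_cat mem_enum [#|B|]cardE.
  case: ifP => [xB|_]; first by rewrite index_mem mem_enum.
  by rewrite ltnNge leq_addr.
move=> dSJ dSJ' cS cJ.
pose f x := nth x (L S' J') (index x (L S J)).
have index_lt x : (index x (L S J) < size (L S' J'))%N.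
  have -> : size (L S' J') = size (L S J) by rewrite !sizeL.
  by rewrite index_mem.
have indexf x : index (f x) (L S' J') = index x (L S J).
  by rewrite index_uniq // uniqL.
have f_inj : injective f.
  move=> x x' /(congr1 (index^~ (L S' J'))); rewrite /= !indexf.
  exact: index_inj (memL _ _ _).
have fS x : (f x \in S') = (x \in S) by rewrite !(indexS _ _ _ dSJ) !(indexS _ _ _ dSJ') indexf cS.
have fJ x : (f x \in J') = (x \in J).
  have := indexSJ _ _ (f x) dSJ'; rewrite indexf -cS -cJ -indexSJ // fS.
  case xS: (x \in S) => //= _.
  by rewrite (disjointFr dSJ xS) (disjointFr dSJ') // fS.
exists f; split=> [|x x']; first exact: injF_bij.
by rewrite /block_graph !fS !fJ (inj_eq f_inj).
Qed.

Section Extremal.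
Variables n k d : nat.
Hypothesis dn : ((k + 2) * d <= n)%N.

Let N := (n - (k + 1) * d)%N.
Let S0 := [set i : 'I_n | (i < d)%N].
Let J0 := [set i : 'I_n | (N <= i)%N].

Lemma extremal_blockE : extremal_graph n k d =2 block_graph S0 J0.
Proof.
move=> i j; rewrite /extremal_graph /block_graph !inE gtn_min gtn_max.
by rewrite -!ltnNge orbA.
Qed.

Lemma card_ord_lt m : (m <= n)%N -> #|[set i : 'I_n | (i < m)%N]| = m.
Proof.
move=> mn; rewrite -sum1_card -[RHS]card_ord -sum1_card (big_ord_widen n (fun=> 1%N)) //.
by apply: eq_bigl => i; rewrite inE.
Qed.

Lemma extremal_disjoint : [disjoint S0 & J0].
Proof.
rewrite -setI_eq0; apply/eqP/setP=> i; rewrite !inE /N.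
by apply/negbTE/negP => /andP[]; lia.
Qed.

Lemma card_extremal_S : #|S0| = d.
Proof. by rewrite card_ord_lt //; lia. Qed.

Lemma card_extremal_J : #|J0| = ((k + 1) * d)%N.
Proof.
have -> : J0 = ~: [set i : 'I_n | (i < N)%N].
  by apply/setP=> i; rewrite !inE -leqNgt.
rewrite cardsCs setCK card_ord card_ord_lt /N; lia.
Qed.

Lemma isomorphic_extremal (S J : {set 'I_n}) :
    [disjoint S & J] -> #|S| = d -> #|J| = ((k + 1) * d)%N ->
  isomorphic (block_graph S J) (extremal_graph n k d).
Proof.
move=> dSJ cS cJ.
have [||f [f_bij fE]] := block_isomorphic dSJ extremal_disjoint.
- by rewrite card_extremal_S.
- by rewrite card_extremal_J.
by exists f; split=> // x y; rewrite extremal_blockE.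
Qed.

End Extremal.

Lemma extremal_sym n k d : symmetric (extremal_graph n k d).
Proof. by move=> i j; rewrite /extremal_graph eq_sym minnC maxnC. Qed.

(** * Spectral bounds for block graphs *)

Section BlockBounds.
Variables (n : nat) (S J : {set 'I_n}).
Hypotheses (disjSJ : [disjoint S & J]) (S_neq0 : S != set0).
Let s : algC := #|S|%:R.
Let q : algC := #|J|%:R.
Let r : algC := #|~: (S :|: J)|%:R.

(** The test vector is the indicator of the clique formed by the vertices outside [J]. *)
Lemma block_rho_ge : s + r - 1 <= rho (block_graph S J).
Proof.
have [j0 j0S] := set0Pn _ S_neq0.
have w_ge0 i : 0 <= block_vector S J 1 0 i.
  by rewrite /block_vector; case: ifP => // _; case: ifP.
apply: (le_rho (@block_sym _ S J) (j0 := j0) w_ge0) => [|j].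
  by rewrite /block_vector j0S.
rewrite block_row_sum // /block_vector; case: ifP => _.
  by rewrite !mulr1 mulr0 addr0 addrAC.
by case: ifP => _; rewrite ?mulr0 ?ler0n ?mulr1 ?addrA.
Qed.

(** If the inequality failed, the block vector would satisfy the hypotheses of [lt_rho], strictly on
    [S], and the spectral radius would exceed [x]. *)
Lemma block_rho_le b c x : x \is Num.real -> 0 <= b -> 0 <= c ->
    x * c <= s -> x * b <= s + (r - 1) * b -> rho (block_graph S J) <= x ->
  s - 1 + r * b + q * c <= x.
Proof.
move=> x_real b0 c0 xc xb; apply: contraTT => lt_x.
have [j0 j0S] := set0Pn _ S_neq0.
have {}lt_x : x < s - 1 + r * b + q * c.
  rewrite real_ltNge // /s /r /q !rpredD ?rpredM ?rpredN ?realn ?real1 //;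
  exact: ger0_real.
have lt_rho_x : x < rho (block_graph S J); last first.
  by rewrite real_leNgt ?lt_rho_x // rho_real.
have w_ge0 i : 0 <= block_vector S J b c i.
  by rewrite /block_vector; case: ifP => // _; case: ifP.
apply: (lt_rho (@block_sym _ S J) (j0 := j0) w_ge0).
- by rewrite /block_vector j0S.
- move=> j; rewrite block_row_sum // /block_vector; case: ifP => _.
    by rewrite mulr1 ltW.
  by case: ifP.
- by rewrite block_row_sum // /block_vector j0S mulr1.
Qed.

(** Let A and B be the adjacency matrices of [e] and of the block graph, [y] the Perron vector of
    [e] and [v] the block vector. If [rho e = x], then x y.v = y.Av <= y.Bv < x y.v. *)
Lemma sub_block_rho_lt (e : rel 'I_n) b c x :
    symmetric e -> gconnected e -> subrel e (block_graph S J) ->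
    0 <= b -> 0 <= c -> s <= x * c -> s + (r - 1) * b <= x * b ->
    s - 1 + r * b + q * c < x ->
  rho e != x.
Proof.
move=> sym_e conn_e sub_e b0 c0 xc xb lt_x; apply/eqP=> rhoE.
have [j0 j0S] := set0Pn _ S_neq0.
have n_gt0 : (0 < n)%N by apply: leq_ltn_trans (ltn_ord j0).
have [y [y_gt0 yE]] := perron sym_e n_gt0 conn_e.
pose v := block_vector S J b c.
have v_ge0 i : 0 <= v i.
  by rewrite /v /block_vector; case: ifP => // _; case: ifP.
pose Av j := \sum_i v i * (block_graph S J i j)%:R.
have Av_le j : Av j <= x * v j.
  rewrite /Av block_row_sum // /v /block_vector; case: ifP => _.
    by rewrite mulr1 ltW.
  by case: ifP.
have Av_lt : Av j0 < x * v j0.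
  by rewrite /Av block_row_sum // /v /block_vector j0S mulr1.
have : \sum_j y j * Av j < \sum_j y j * (x * v j).
  rewrite (bigD1 j0) //= [ltRHS](bigD1 j0) //=.
  apply: ltr_leD; first by rewrite ltr_pM2l.
  by apply: ler_sum => j _; rewrite ler_pM2l.
apply/negP; rewrite -real_leNgt; first last.
- apply: sum_real => j _; apply: realM; first exact: gtr0_real.
  by apply: sum_real => i _; apply: realM; rewrite ?realn ?ger0_real.
- apply: sum_real => j _; apply: realM; first exact: gtr0_real.
  by apply: realM; [rewrite -rhoE rho_real | exact: ger0_real].
have -> : \sum_j y j * (x * v j) = \sum_j y j * \sum_i v i * (e i j)%:R.
  transitivity (\sum_j \sum_i y i * (e i j)%:R * v j).
    by apply: eq_bigr => j _; rewrite -mulr_suml yE rhoE mulrCA mulrA.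
  rewrite exchange_big /=; apply: eq_bigr => i _; rewrite mulr_sumr.
  by apply: eq_bigr => j _; rewrite sym_e mulrAC mulrA.
apply: ler_sum => j _; rewrite ler_pM2l //; apply: ler_sum => i _.
rewrite ler_wpM2l // ler_nat.
by case eij: (e i j); rewrite // sub_e.
Qed.

(** The Perron vector of [e] is a test vector for the larger graph, with strict inequality at an end
    of a missing edge. *)
Lemma proper_sub_block_rho_lt (e : rel 'I_n) :
    symmetric e -> gconnected e -> subrel e (block_graph S J) ->
    ~ e =2 block_graph S J ->
  rho e < rho (block_graph S J).
Proof.
move=> sym_e conn_e sub_e neq_e.
have [i0 [j0 ij0]] : exists i, exists j, e i j != block_graph S J i j.
  have [/existsP[i /existsP[j ij]]|/existsPn all_eq] :=
    boolP [exists i, exists j, e i j != block_graph S J i j]; first by exists i, j.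
  case: neq_e => i j; have /existsPn/(_ j) := all_eq i.
  by rewrite negbK => /eqP.
have n_gt0 : (0 < n)%N by apply: leq_ltn_trans (ltn_ord j0).
have [y [y_gt0 yE]] := perron sym_e n_gt0 conn_e.
have le_e i j : y i * (e i j)%:R <= y i * (block_graph S J i j)%:R.
  rewrite ler_pM2l // ler_nat.
  by case eij: (e i j); rewrite // sub_e.
apply: (lt_rho (@block_sym _ S J) (w := y) (j0 := j0)) => [i|//|j|].
- exact: ltW.
- by rewrite -yE ler_sum.
- rewrite -yE (bigD1 i0) //= [ltRHS](bigD1 i0) //=.
  apply: ltr_leD; last by apply: ler_sum.
  rewrite ltr_pM2l // ltr_nat; case eij: (e i0 j0) ij0 => /=.
    by rewrite sub_e.
  by case: block_graph.
Qed.

End BlockBounds.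

(* With [p = k + 1] and [m] the order of the large clique, the two sides are
   the two forms of the characteristic equation of the quotient matrix of
   [K_s \/ (K_{m-s} + I_{ps})], where [E = x + 1 - m]. *)
Lemma quotient_equationE (F : fieldType) (x E s p : F) :
    x != 0 -> E + s != 0 ->
  x - (s - 1 + (x + 1 - E - s) * (s / (E + s)) + p * s * (s / x)) =
  (x * (x + 1) * E - p * s ^+ 2 * (E + s)) / (x * (E + s)).
Proof. by move=> x0 Es0; field; rewrite Es0 x0. Qed.

(** With x = m + E - 1, the value s / (E + s) solves the eigenvalue equation on the large clique
    exactly. *)
Lemma clique_equationE (F : fieldType) (m E s : F) : E + s != 0 ->
  s + (m - s - 1) * (s / (E + s)) = (m + E - 1) * (s / (E + s)).
Proof. by move=> Es0; field. Qed.

(** The lower bound on [n] gives 9d <= n and 3N >= 2n + 2, and [sn] gives 3s <= n. So the left side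
    is at most 31n^2/81, while N(N - 1) exceeds 4n^2/9 = 36n^2/81. *)
Lemma order_bounds (k n d s N : nat) :
    (1 <= d)%N -> (d < s)%N -> (1 <= k)%N -> ((k + 2) * s <= n)%N ->
    (3 * (k + 2) * d + 2 <= n)%N -> (N + (k + 1) * d = n)%N ->
  (d * (d + s) + (k + 2) * s ^ 2 < N * N.-1)%N /\ (d + s <= N.*2.-1)%N.
Proof.
move=> d1 ds k1 sn dn Nn.
have sn3 : (3 * s <= n)%N by nia.
have dn9 : (9 * d <= n)%N by nia.
have N3 : (2 * n + 2 <= 3 * N)%N by nia.
split; last by lia.
have h1 : ((k + 2) * s ^ 2 <= n * s)%N by rewrite -mulnn mulnA leq_mul2r sn orbT.
have h2 : (3 * (n * s) <= n * n)%N by nia.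
have h3 : (9 * (d * (d + s)) <= n * (d + s))%N by nia.
have h4 : (9 * (n * (d + s)) <= 4 * (n * n))%N by nia.
have h5 : ((2 * n + 2) * (2 * n - 1) <= 9 * (N * N.-1))%N.
  rewrite (_ : 9 * (N * N.-1) = (3 * N) * (3 * N.-1))%N; last by ring.
  by apply: leq_mul; lia.
nia.
Qed.

(** The increment from d to d + t is p t times a sum of three terms: a positive one by [lt_sq], E
    times a nonnegative one by [le_lin], and E^2. *)
Lemma quotient_sign_increase (R : numDomainType) (x E p d t N : R) :
    0 <= E -> 0 < p -> 0 < t -> x + 1 = N + E ->
    d * (d + (d + t)) + (p + 1) * (d + t) ^+ 2 < N * (N - 1) ->
    d + (d + t) <= N + N - 1 ->
    0 <= x * (x + 1) * E - p * d ^+ 2 * (E + d) ->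
  0 < x * (x + 1) * (E + p * t)
      - p * (d + t) ^+ 2 * (E + p * t + (d + t)).
Proof.
move=> E0 p0 t0 xN lt_sq le_lin ge0.
have xE : x = N + E - 1 by rewrite -xN addrK.
have -> : x * (x + 1) * (E + p * t)
      - p * (d + t) ^+ 2 * (E + p * t + (d + t)) =
   (x * (x + 1) * E - p * d ^+ 2 * (E + d))
   + p * t * ((N * (N - 1) - (d * (d + (d + t)) + (p + 1) * (d + t) ^+ 2))
              + E * (N + N - 1 - (d + (d + t))) + E ^+ 2).
  by rewrite xE; ring.
rewrite ltr_wpDl // mulr_gt0 ?mulr_gt0 // -addrA ltr_wpDr ?subr_gt0 //.
by rewrite addr_ge0 ?exprn_ge0 // mulr_ge0 ?subr_ge0.
Qed.

Theorem rho_block_isomorphic (k n d : nat) (e : rel 'I_n) (S J : {set 'I_n}) :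
    (1 <= k)%N -> (1 <= d)%N -> (3 * (k + 2) * d + 2 <= n)%N ->
    simple_graph e -> gconnected e -> (d <= #|S|)%N ->
    [disjoint S & J] -> #|J| = ((k + 1) * #|S|)%N ->
    subrel e (block_graph S J) ->
    rho (extremal_graph n k d) <= rho e ->
  isomorphic e (extremal_graph n k d).
Proof.
move=> k1 d1 dn [sym_e irr_e] conn_e dS disSJ cJ sub_e le_rho_e.
have n_gt0 : (0 < n)%N by lia.
have dn' : ((k + 2) * d <= n)%N by lia.
have S_neq0 : S != set0 by rewrite -card_gt0; lia.
have cards := card_blocks disSJ.
case: (ltngtP d #|S|) dS => // [lt_dS|dS] _; last first.
  (* Here the block graph is a copy of the extremal graph, so [e] equals it or has a smaller
     spectral radius. *)
  have isoSJ := isomorphic_extremal dn' disSJ (esym dS).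
  rewrite dS in isoSJ; move: (isoSJ cJ) => {}isoSJ; rewrite -dS in isoSJ.
  case: (boolP [forall i, forall j, e i j == block_graph S J i j]).
    move=> /forallP eE; have [f [f_bij fE]] := isoSJ.
    exists f; split=> // x y; rewrite -fE.
    by have /forallP/(_ y)/eqP := eE x.
  move=> neq; have lt_rho_e : rho e < rho (block_graph S J).
    apply: proper_sub_block_rho_lt => // eE; case/negP: neq.
    by apply/forallP=> i; apply/forallP=> j; rewrite eE.
  suff le_rho_SJ : rho (block_graph S J) <= rho e by rewrite (le_gtF le_rho_SJ) in lt_rho_e.
  apply: le_trans le_rho_e.
  by apply: rho_isomorphic => //; [apply: block_sym | apply: extremal_sym].
pose N := (n - (k + 1) * d)%N.
have Nn : (N + (k + 1) * d = n)%N by rewrite /N; lia.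
have sn : ((k + 2) * #|S| <= n)%N by lia.
have [bnd1 bnd2] := order_bounds d1 lt_dS k1 sn dn Nn.
pose x := rho e; pose S0 := [set i : 'I_n | (i < d)%N].
pose J0 := [set i : 'I_n | (N <= i)%N].
have dis0 : [disjoint S0 & J0] := extremal_disjoint dn'.
have cS0 : #|S0| = d := card_extremal_S dn'.
have cJ0 : #|J0| = ((k + 1) * d)%N := card_extremal_J dn'.
have := card_blocks dis0; rewrite cS0 cJ0 => cards0.
have S0_neq0 : S0 != set0 by rewrite -card_gt0 cS0.
have le_rho0 : rho (block_graph S0 J0) <= x.
  apply: le_trans le_rho_e; apply: rho_isomorphic => //.
  - exact: block_sym.
  - exact: extremal_sym.
  - exact: isomorphic_extremal.
have N_gt0 : (0 < N)%N by rewrite /N; lia.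
have NE : N%:R = 1 + (N.-1)%:R :> algC by rewrite -mulrS prednK.
pose E : algC := x + 1 - N%:R; pose p : algC := (k + 1)%:R.
have r0E : #|~: (S0 :|: J0)|%:R = N%:R - d%:R :> algC.
  rewrite -natrB; last lia. congr _%:R; apply/eqP; rewrite -(eqn_add2l (d + (k + 1) * d)) cards0; apply/eqP; lia.
have x1E : x + 1 = N%:R + E by rewrite /E; ring.
(* The extremal graph contains a clique of order [N], so x >= N - 1. *)
have E0 : 0 <= E.
  have := le_trans (block_rho_ge dis0 S0_neq0) le_rho0.
  rewrite r0E cS0 /E => le_x; rewrite -subr_ge0 in le_x.
  by rewrite (le_trans le_x) // le_eqVlt; apply/orP; left; apply/eqP; ring.
have x0 : 0 < x.
  have -> : x = (N.-1)%:R + E.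
    by rewrite /E NE; ring.
  by rewrite ltr_wpDr // ltr0n; lia.
have d0 : 0 < d%:R :> algC by rewrite ltr0n.
have Ed0 : 0 < E + d%:R by rewrite ltr_wpDl.
(* The values d / (E + d) and d / x solve the eigenvalue equations off [S0]; the remaining equation,
   on [S0], becomes an inequality. *)
have Q0 : d%:R - 1 + (N%:R - d%:R) * (d%:R / (E + d%:R)) + p * d%:R * (d%:R / x) <= x.
  rewrite -r0E /p -natrM -cJ0 -[in d%:R - 1]cS0.
  apply: block_rho_le => //; rewrite ?rho_real ?divr_ge0 ?ler0n ?(ltW x0) ?(ltW Ed0) //.
  - by rewrite cS0 mulrCA divff ?gt_eqF // mulr1.
  - rewrite cS0 r0E clique_equationE ?gt_eqF // le_eqVlt; apply/orP; left; apply/eqP.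
    by congr (_ * _); rewrite /E; ring.
have sign0 : 0 <= x * (x + 1) * E - p * d%:R ^+ 2 * (E + d%:R).
  rewrite -subr_ge0 in Q0; move: Q0.
  rewrite (_ : N%:R - d%:R = x + 1 - E - d%:R); last by rewrite x1E; ring.
  rewrite quotient_equationE ?gt_eqF // pmulr_lge0 // invr_gt0 mulr_gt0 //.
pose t := (#|S| - d)%N.
have cS : #|S|%:R = d%:R + t%:R :> algC by rewrite -natrD /t subnKC // ltnW.
have t0 : 0 < t%:R :> algC by rewrite ltr0n subn_gt0.
have p0 : 0 < p by rewrite /p addn1 ltr0Sn.
pose s : algC := #|S|%:R; have s0 : 0 < s by rewrite ltr0n card_gt0.
have rE : #|~: (S :|: J)|%:R = N%:R - p * t%:R - s.
  apply/eqP; rewrite -subr_eq0 /s /p; apply/eqP.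
  have : (#|S| + (k + 1) * #|S| + #|~: (S :|: J)| = N + (k + 1) * d)%N by rewrite Nn -cJ.
  move/(congr1 (fun m => m%:R : algC)); rewrite !natrD !natrM !natrD cS => eqn.
  set r := #|~: _|%:R in eqn *; set q := k%:R + 1%:R in eqn *.
  have -> : r = d%:R + t%:R + q * (d%:R + t%:R) + r - (d%:R + t%:R) - q * (d%:R + t%:R) by ring.
  by rewrite eqn; ring.
(* Passing from [d] to [#|S|] shrinks the clique outside [J] from order N to N - p t, so E grows by
   p t. *)
pose Es := E + p * t%:R.
have Es0 : 0 < Es + s by rewrite ltr_wpDl // addr_ge0 // mulr_ge0 ?ltW.
have sign_s : 0 < x * (x + 1) * Es - p * s ^+ 2 * (Es + s).
  rewrite /s cS; apply: (@quotient_sign_increase _ _ _ _ _ _ N%:R) => //.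
  - have -> : N%:R - 1 = (N.-1)%:R :> algC by rewrite NE addrC addKr.
    have -> : p + 1 = (k + 2)%:R by rewrite /p -[1]/1%:R -natrD -addnA.
    by rewrite -cS -!(natrD, natrM, natrX) ltr_nat.
  - have -> : N%:R + N%:R - 1 = (N.*2.-1)%:R :> algC.
      by rewrite -natrD addnn -[N.*2 in LHS]prednK ?double_gt0 // mulrS; ring.
    by rewrite -cS -natrD ler_nat.
(* With x equal to [rho e], the conclusion [rho e != x] is the contradiction sought. *)
have := @sub_block_rho_lt n S J disSJ S_neq0 e (s / (Es + s)) (s / x) x sym_e conn_e sub_e.
rewrite rE -/s eqxx => absurd.
suff : ~~ true by [].
apply: absurd; rewrite ?divr_ge0 ?ler0n ?(ltW x0) ?(ltW Es0) //.
- by rewrite mulrCA divff ?gt_eqF // mulr1.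
- rewrite clique_equationE ?gt_eqF // le_eqVlt; apply/orP; left; apply/eqP.
  by congr (_ * _); rewrite /Es /E; ring.
- rewrite -subr_gt0 cJ natrM -/s -/p.
  rewrite (_ : N%:R - p * t%:R - s = x + 1 - Es - s); last by rewrite x1E /Es; ring.
  by rewrite quotient_equationE ?gt_eqF // divr_gt0 // mulr_gt0.
Qed.

(** * Minimum degree and conclusion *)

Lemma min_degree_le n (e : rel 'I_n) x : (min_degree e <= deg e x)%N.
Proof.
rewrite /min_degree; elim: (index_enum _) (mem_index_enum x) => //= y s IHs.
rewrite inE big_cons geq_min => /predU1P[->|/IHs ->]; rewrite ?leqnn ?orbT //.
Qed.

Lemma min_degree_gt0 n (e : rel 'I_n) :
  gconnected e -> (1 < n)%N -> (0 < min_degree e)%N.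
Proof.
move=> conn_e n_gt1; rewrite /min_degree; elim/big_ind: _ => [|a b|x _].
(* This is the default value [n] of the minimum. *)
- exact: ltnW.
- by rewrite leq_min => -> ->.
- have [y exy] := connected_nbr conn_e n_gt1 x.
  by apply/card_gt0P; exists y; rewrite inE.
Qed.

Lemma subset_of_card (T : finType) (A : {set T}) m : (m <= #|A|)%N ->
  exists2 B : {set T}, B \subset A & #|B| = m.
Proof.
move=> mA; exists [set x in take m (enum A)].
  by apply/subsetP=> x; rewrite inE => /mem_take; rewrite mem_enum.
rewrite cardsE (card_uniqP _) ?take_uniq ?enum_uniq //.
by rewrite size_takel // -cardE.
Qed.

Theorem theorem1p14 (k n delta : nat) (e : rel 'I_n) :
  (1 <= k)%N ->
  simple_graph e ->
  gconnected e ->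
  min_degree e = delta ->
  (3 * (k + 2) * delta + 2 <= n)%N ->
  rho (extremal_graph n k delta) <= rho e ->
  ~ isomorphic e (extremal_graph n k delta) ->
  exists t : rel 'I_n, spanning_tree e t /\ (leaf_degree t <= k)%N.
Proof.
move=> k_gt0 simple_e conn_e delta_e n_big le_rho_e not_iso.
have [sym_e irr_e] := simple_e.
have n_gt1 : (1 < n)%N by lia.
have delta_gt0 : (0 < delta)%N by rewrite -delta_e min_degree_gt0.
have n_gt3 : (3 < n)%N by nia.
case: (boolP [forall S : {set 'I_n}, (S != set0) ==> (#|isolated e S| < k.+1 * #|S|)%N]).
  move=> /forallP few_iso; apply: spanning_tree_leaf_degree => // S.
  by apply/implyP.
move=> /forallPn[S]; rewrite negb_imply -leqNgt => /andP[S_neq0 many_iso].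
(* Trimming the isolated vertices to exactly [k.+1 * #|S|] gives the independent part; the others
   join the clique. *)
have [J J_iso cJ] := subset_of_card many_iso.
have J_nbr i j : i \in J -> e i j -> j \in S.
  move=> /(subsetP J_iso); rewrite inE => /andP[_ /forallP/(_ j)/implyP].
  by apply.
case: not_iso; apply: (@rho_block_isomorphic k n delta e S J) => //.
(* All neighbours of a vertex of [J] lie in [S], so its degree is at most [#|S|]. *)
- have [i iJ] : exists i, i \in J.
    by apply/card_gt0P; rewrite cJ muln_gt0 card_gt0.
  rewrite -delta_e; apply: leq_trans (min_degree_le e i) _.
  by apply/subset_leq_card/subsetP=> j; rewrite inE; apply: J_nbr.
- rewrite disjoint_sym disjoint_subset; apply/subsetP=> i /(subsetP J_iso).
  by rewrite !inE => /andP[].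
- by rewrite cJ addn1.
- move=> i j eij; rewrite /block_graph; apply/andP; split.
    by apply: contraTneq eij => ->; rewrite irr_e.
  case iS: (i \in S) => //; case jS: (j \in S) => //=.
  apply/andP; split; apply/negP => /J_nbr h.
    by rewrite (h j eij) in jS.
  by rewrite (h i) ?iS // sym_e in iS.
Qed.
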